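(* Let $A,B\subseteq\mathbb{N}^{\mathbb{N}}$, let $X,Y,Z$ be represented spaces and let $g:\subseteq X\rightrightarrows Y$ and $f:\subseteq Y\rightrightarrows Z$ be multi-valued functions. If $f\leq_{\mathrm W}\mathsf{C}_A$ and $g\leq_{\mathrm W}\mathsf{C}_B$, then $f\circ g\leq_{\mathrm W}\mathsf{C}_{A\times B}$.
   Context: Baire space is $\mathbb{N}^{\mathbb{N}}$, with its usual product topology and a fixed computable bijective pairing $\langle\cdot,\cdot\rangle$ on it. Computability of partial functions $F:\subseteq\mathbb{N}^{\mathbb{N}}\to\mathbb{N}^{\mathbb{N}}$ is meant via (type-2) Turing machines. A representation of a set $X$ is a surjective partial function $\delta:\subseteq\mathbb{N}^{\mathbb{N}}\to X$; $(X,\delta)$ is a represented space. $f:\subseteq X\rightrightarrows Y$ denotes a partial multi-valued function ($f(x)\neq\emptyset$ for $x\in\mathrm{dom}(f)$). The composition of $g:\subseteq X\rightrightarrows Y$ and $f:\subseteq Y\rightrightarrows Z$ has domain $\{x\in\mathrm{dom}(g):g(x)\subseteq\mathrm{dom}(f)\}$ and values $(f\circ g)(x)=\bigcup_{y\in g(x)}f(y)$. A realizer of $f:\subseteq(X,\delta_X)\rightrightarrows(Y,\delta_Y)$, written $F\vdash f$, is a single-valued $F:\subseteq\mathbb{N}^{\mathbb{N}}\to\mathbb{N}^{\mathbb{N}}$ with $\delta_Y F(p)\in f\delta_X(p)$ for all $p\in\mathrm{dom}(f\delta_X)$. Weihrauch reducibility $f\leq_{\mathrm W}g$ means: there are computable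 $K,H:\subseteq\mathbb{N}^{\mathbb{N}}\to\mathbb{N}^{\mathbb{N}}$ such that $p\mapsto K\langle p,GH(p)\rangle$ is a realizer of $f$ for every $G\vdash g$. Sierpiński space $\mathbb{S}=\{0,1\}$ has topology $\{\emptyset,\{1\},\{0,1\}\}$ and representation $\delta_{\mathbb{S}}(p)=1\iff(\exists n)\,p(n)=0$. For a represented space $(X,\delta)$, a set $U\subseteq X$ is open if its characteristic function $\chi_U:X\to\mathbb{S}$ has a continuous realizer, and closed sets are the complements of open sets. $\mathcal{A}_-(X)$ is the set of closed subsets of $X$ with the representation $\psi_-^X$: a name of $A$ is a name of $\chi_{X\setminus A}$ in the canonical function space representation $[\delta\to\delta_{\mathbb{S}}]$ (a name $nq$, $n\in\mathbb N$, $q\in\mathbb{N}^{\mathbb{N}}$, names $\chi$ iff $r\mapsto\Phi_n\langle q,r\rangle$ is a realizer of $\chi$, where $\Phi_n$ is the $n$-th computable partial function on $\mathbb{N}^{\mathbb{N}}$). Closed choice is $\mathsf{C}_X:\subseteq\mathcal{A}_-(X)\rightrightarrows X,\ A\mapsto A$ with domain the non-empty closed sets (any point of $A$ is an admissible output). A subset $A\subseteq\mathbb{N}^{\mathbb{N}}$ is regarded as a represented space via the restriction of the identity; for $A,B\subseteq\mathbb{N}^{\mathbb{N}}$, $A\times B$ is regarded as a subspace of $\mathbb{N}^{\mathbb{N}}$ via the pairing function. *)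

(* Defs.v *)
From mathcomp Require Import all_boot.

Set Implicit Arguments.
Unset Strict Implicit.
Unset Printing Implicit Defensive.

(** * Baire space *)

Definition baire := nat -> nat.

Definition bpair (p q : baire) : baire :=
  fun n => if odd n then q n./2 else p n./2.

Definition btail (p : baire) : baire := fun i => p i.+1.

Definition agree (m : nat) (p q : baire) := forall i, i < m -> p i = q i.

(** * Type-2 Turing machines

    Multi-tape machines in flowchart form: the control states are the positions
    of a list of instructions, and each state performs one elementary action
    and names its successor state(s).  The input tape is read-only and one-way,
    the output tape is write-only and one-way; both carry symbols of {0,1}
    ([false], [true]).  The work tapes are two-way infinite; their alphabet is
    the finite set of symbols occurring in the program together with the
    blank, 0.  A work tape that is not mentioned in the program stays blank, so
    the number of work tapes is finite too. *)

Inductive instr :=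
| Halt
| MoveL (tape next : nat)
| MoveR (tape next : nat)
| Write (tape symbol next : nat)
| Test (tape symbol next_eq next_neq : nat)
| Read (next0 next1 : nat)      (* also advances the input head *)
| Out (b : bool) (next : nat).

Definition machine := seq instr.

(* [lcells] and [rcells] list the cells to the left and to the right of the
   head, nearest first; all cells beyond the two lists are blank. *)
Record tape := Tape { lcells : seq nat; scanned : nat; rcells : seq nat }.

Definition blank_tape := Tape [::] 0 [::].

Definition move_left (t : tape) :=
  Tape (behead (lcells t)) (head 0 (lcells t)) (scanned t :: rcells t).
Definition move_right (t : tape) :=
  Tape (scanned t :: lcells t) (head 0 (rcells t)) (behead (rcells t)).
Definition write (a : nat) (t : tape) := Tape (lcells t) a (rcells t).

Record config := Config {
  state : nat;
  input_pos : nat;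
  work : seq tape;              (* tapes beyond this list are blank *)
  output : seq bool }.

Definition init_config := Config 0 0 [::] [::].

Definition work_tape (c : config) (i : nat) := nth blank_tape (work c) i.
Definition update_tape (c : config) (i : nat) (f : tape -> tape) :=
  set_nth blank_tape (work c) i (f (work_tape c i)).

Definition step (M : machine) (u : nat -> bool) (c : config) : config :=
  match nth Halt M (state c) with
  | Halt => c
  | MoveL i s => Config s (input_pos c) (update_tape c i move_left) (output c)
  | MoveR i s => Config s (input_pos c) (update_tape c i move_right) (output c)
  | Write i a s => Config s (input_pos c) (update_tape c i (write a)) (output c)
  | Test i a s s' =>
      Config (if scanned (work_tape c i) == a then s else s')
             (input_pos c) (work c) (output c)
  | Read s0 s1 =>
      Config (if u (input_pos c) then s1 else s0)
             (input_pos c).+1 (work c) (output c)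
  | Out b s => Config s (input_pos c) (work c) (rcons (output c) b)
  end.

Definition run (M : machine) (u : nat -> bool) (t : nat) : config :=
  iter t (step M u) init_config.

(* The point p is written on a tape as 1^(p 0) 0 1^(p 1) 0 ... *)
Definition unary_prefix (p : baire) (k : nat) : seq bool :=
  flatten [seq rcons (nseq (p i) true) false | i <- iota 0 k].

(* The first j+1 blocks contain at least j+1 symbols. *)
Definition unary (p : baire) (j : nat) : bool :=
  nth false (unary_prefix p j.+1) j.

(* On input p the machine writes exactly the infinite sequence coding q. *)
Definition machine_fun (M : machine) (p q : baire) : Prop :=
  forall k, exists t, prefix (unary_prefix q k) (output (run M (unary p) t)).

(* The fixed numbering of all machines. *)
Definition code_instr (o : instr) : seq nat :=
  match o with
  | Halt => [::]
  | MoveL i s => [:: 0; i; s]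
  | MoveR i s => [:: 1; i; s]
  | Write i a s => [:: 2; i; a; s]
  | Test i a s s' => [:: 3; i; a; s; s']
  | Read s0 s1 => [:: 4; s0; s1]
  | Out b s => [:: 5; nat_of_bool b; s]
  end.

Definition decode_instr (l : seq nat) : instr :=
  match l with
  | [:: 0; i; s] => MoveL i s
  | [:: 1; i; s] => MoveR i s
  | [:: 2; i; a; s] => Write i a s
  | [:: 3; i; a; s; s'] => Test i a s s'
  | [:: 4; s0; s1] => Read s0 s1
  | [:: 5; b; s] => Out (b != 0) s
  | _ => Halt
  end.

Definition code_machine (M : machine) : nat :=
  CodeSeq.code [seq CodeSeq.code (code_instr o) | o <- M].

Definition nth_machine (n : nat) : machine :=
  [seq decode_instr (CodeSeq.decode m) | m <- CodeSeq.decode n].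

Lemma code_machineK : cancel code_machine nth_machine.
Proof.
rewrite /nth_machine /code_machine => M; rewrite CodeSeq.codeK.
by elim: M => //= o M ->; rewrite CodeSeq.codeK; case: o => // -[].
Qed.

Definition Phi (n : nat) : baire -> baire -> Prop := machine_fun (nth_machine n).

(** * Multi-valued functions and represented spaces

    A partial multi-valued function is a relation; partial functions, including
    representations and the partial functions on Baire space, are the
    single-valued ones. *)

Definition mvfun (X Y : Type) := X -> Y -> Prop.

Definition dom X Y (f : mvfun X Y) (x : X) : Prop := exists y, f x y.

Definition single_valued X Y (f : mvfun X Y) : Prop :=
  forall x y y', f x y -> f x y' -> y = y'.

(* Note the order: [mvcomp f g] is "f after g". *)
Definition mvcomp X Y Z (f : mvfun Y Z) (g : mvfun X Y) : mvfun X Z :=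
  fun x z => [/\ dom g x, forall y, g x y -> dom f y & exists2 y, g x y & f y z].

Definition computable (F : mvfun baire baire) : Prop :=
  exists n, forall p q, F p q <-> Phi n p q.

Definition continuous (F : mvfun baire baire) : Prop :=
  forall p q, F p q -> forall n, exists m,
  forall p' q', F p' q' -> agree m p p' -> agree n q q'.

Definition representation X (dX : mvfun baire X) : Prop :=
  single_valued dX /\ forall x, exists p, dX p x.

Definition realizer X Y (dX : mvfun baire X) (dY : mvfun baire Y)
    (F : mvfun baire baire) (f : mvfun X Y) : Prop :=
  single_valued F /\
  forall p x, dX p x -> dom f x -> exists q y, [/\ F p q, dY q y & f x y].

Definition weihrauch_le X Y U V
    (dX : mvfun baire X) (dY : mvfun baire Y) (f : mvfun X Y)
    (dU : mvfun baire U) (dV : mvfun baire V) (g : mvfun U V) : Prop :=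
  exists K H : mvfun baire baire,
  [/\ computable K, computable H &
      forall G, realizer dU dV G g ->
        realizer dX dY
          (fun p r => exists h s, [/\ H p h, G h s & K (bpair p s) r]) f].

(** * Closed sets and closed choice *)

Definition sierp_rep : mvfun baire bool :=
  fun p b => b = true <-> exists n, p n = 0.

Definition chi X (U : X -> Prop) : mvfun X bool := fun x b => b = true <-> U x.

Definition is_open X (dX : mvfun baire X) (U : X -> Prop) : Prop :=
  exists2 F, realizer dX sierp_rep F (chi U) & continuous F.

Definition is_closed X (dX : mvfun baire X) (A : X -> Prop) : Prop :=
  is_open dX (fun x => ~ A x).

Definition closed_set X (dX : mvfun baire X) :=
  {A : X -> Prop | is_closed dX A}.

(* On total single-valued functions f this is the representation [dX -> dY]. *)
Definition fun_rep X Y (dX : mvfun baire X) (dY : mvfun baire Y) :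
    mvfun baire (mvfun X Y) :=
  fun p f => realizer dX dY (fun r s => Phi (p 0) (bpair (btail p) r) s) f.

Definition psi_minus X (dX : mvfun baire X) : mvfun baire (closed_set dX) :=
  fun p A => fun_rep dX sierp_rep p (chi (fun x => ~ sval A x)).

(* The domain is the set of non-empty closed sets. *)
Definition closed_choice X (dX : mvfun baire X) : mvfun (closed_set dX) X :=
  fun A x => sval A x.

Definition subspace (A : baire -> Prop) := {p : baire | A p}.

Definition sub_rep (A : baire -> Prop) : mvfun baire (subspace A) :=
  fun p a => p = sval a.

Definition bprod (A B : baire -> Prop) : baire -> Prop :=
  fun r => exists a b, [/\ A a, B b & r = bpair a b].

(* [f] is Weihrauch reducible to closed choice on the subspace A. *)
Definition le_choice X Y (dX : mvfun baire X) (dY : mvfun baire Y)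
    (f : mvfun X Y) (A : baire -> Prop) : Prop :=
  weihrauch_le dX dY f
    (@psi_minus _ (@sub_rep A)) (@sub_rep A) (@closed_choice _ (@sub_rep A)).

(* Main.v *)
Require Import Defs.
From mathcomp Require Import all_boot zify.
From Stdlib Require Import FunctionalExtensionality Classical ClassicalEpsilon.

Set Implicit Arguments.
Unset Strict Implicit.
Unset Printing Implicit Defensive.

(** Let p be a name of a point x in the domain of f after g.  The reduction of g
    turns p into a name of a non-empty closed set B_p of points of B, each of
    which, together with p, yields a name of a value y of g at x; the reduction
    of f turns that name into a name of a non-empty closed set A_(p,b) of points
    of A, each of which yields a value of f at y.  So one choice suffices: a
    point of the closed set

      C_p = { <a,b> : b in B_p and a in A_(p,b) }

    of points of A x B determines b, then y, then the final value.  What has to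
    be computed from p is a name of C_p, that is, a machine that recognises the
    points <a,b> outside C_p.  It runs two semi-decisions side by side: that b
    is outside B_p, and that a is outside A_(p,b).  If b is outside B_p, then
    A_(p,b) has no meaning and the second run may report anything; but <a,b> is
    then outside C_p, so a false report does no harm.  Each of the two
    semi-decisions runs a machine whose code is read off a name that is itself
    being computed, which calls for a universal machine.

    Two ingredients make this a proof.
    - Closed choice: [choice_reduction_of_le] and [le_of_choice_reduction]
      replace the quantifier over all realizers of closed choice by a statement
      about points of the named set.
    - Computability: [Phi_of_primrec] says that a primitive recursive function
      on finite sequences, applied to longer and longer segments of p,
      computes a function on Baire space as soon as its values converge;
      [tends_simulate] says that running a machine is itself such a limit of a
      primitive recursive function ([pr_simulate]), uniformly in its code.
      Programming on Baire space thus becomes composition of primitive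
      recursive functions on finite sequences, and a computation that might
      diverge is only ever run on finite information for a finite time.

    [Phi_of_primrec] rests on a compiler: primitive recursive functions become
    programs for counters, and a counter is a work tape carrying a block of
    ones. *)

(** * Counter programs on Turing machines *)

Inductive cmd :=
| Skip
| Inc (x : nat)
| Dec (x : nat)
| Seq (c1 c2 : cmd)
| If (x : nat) (c1 c2 : cmd)
| While (x : nat) (c : cmd)
| ReadInc (x : nat)
| Emit (b : bool).

Fixpoint csize (c : cmd) : nat :=
  match c with
  | Skip | Emit _ => 1
  | Inc _ => 2
  | Dec _ | ReadInc _ => 3
  | Seq c1 c2 => csize c1 + csize c2
  | If _ c1 c2 => (csize c1 + csize c2).+1
  | While _ c => (csize c).+1
  end.

(** [o] is the address of the first instruction and [e] the address to which
    control passes at the end. *)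
Fixpoint compile (c : cmd) (o e : nat) : seq instr :=
  match c with
  (* Control can only leave an instruction, so even Skip needs one. *)
  | Skip => [:: Test 0 0 e e]
  | Inc x => [:: MoveR x o.+1; Write x 1 e]
  | Dec x => [:: Test x 0 e o.+1; Write x 0 o.+2; MoveL x e]
  | Seq c1 c2 => compile c1 o (o + csize c1) ++ compile c2 (o + csize c1) e
  | If x c1 c2 => Test x 0 (o.+1 + csize c1) o.+1 ::
      compile c1 o.+1 e ++ compile c2 (o.+1 + csize c1) e
  | While x c => Test x 0 e o.+1 :: compile c o.+1 o
  | ReadInc x => [:: Read e o.+1; MoveR x o.+2; Write x 1 e]
  | Emit b => [:: Out b e]
  end.

Lemma size_compile c o e : size (compile c o e) = csize c.
Proof.
elim: c o e => //= [c1 IH1 c2 IH2|x c1 IH1 c2 IH2|x c IH] o e.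
- by rewrite size_cat IH1 IH2.
- by rewrite size_cat IH1 IH2.
- by rewrite IH.
Qed.

Definition store := nat -> nat.

Definition upd (s : store) (x v : nat) : store := fun y => if y == x then v else s y.

(** A counter is a block of ones that ends under the head.  The value 0 is then
    a blank tape, so the initial configuration has all counters at 0, and the
    scanned symbol tells whether the counter is 0. *)
Definition holds (t : tape) (n : nat) : Prop :=
  (forall i, nth 0 (scanned t :: lcells t) i = (i < n)) /\
  (forall i, nth 0 (rcells t) i = 0).

Definition models (cf : config) (pc : nat) (s : store) (i : nat) (o : seq bool) :=
  [/\ state cf = pc, input_pos cf = i, output cf = o &
      forall x, holds (work_tape cf x) (s x)].

Definition placed (M : machine) (o : nat) (k : seq instr) :=
  forall i, i < size k -> nth Halt M (o + i) = nth Halt k i.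

(** The triple of a program, quantified over the machine in which it is placed
    and over its exit, so that programs can be composed in any position. *)
Definition runs (u : nat -> bool) (c : cmd) (s : store) (i : nat) (w : seq bool)
    (s' : store) (i' : nat) (w' : seq bool) : Prop :=
  forall M o e cf, placed M o (compile c o e) -> models cf o s i w ->
  exists t, models (iter t (step M u) cf) e s' i' w'.

Lemma placed_cat M o k1 k2 :
  placed M o (k1 ++ k2) -> placed M o k1 /\ placed M (o + size k1) k2.
Proof.
move=> H; split=> i lti.
  by rewrite H ?nth_cat ?lti // size_cat ltn_addr.
by rewrite -addnA H ?nth_cat ?size_cat ?ltn_add2l // ltnNge leq_addr /= addKn.
Qed.

Lemma placed_cons M o a k :
  placed M o (a :: k) -> nth Halt M o = a /\ placed M o.+1 k.
Proof.
move=> H; split; first by have := H 0 isT; rewrite addn0.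
by move=> i lti; have := H i.+1 lti; rewrite addnS.
Qed.

Lemma holds_scanned t n : holds t n -> scanned t = (0 < n).
Proof. by case=> /(_ 0). Qed.

Lemma holds_inc t n : holds t n -> holds (write 1 (move_right t)) n.+1.
Proof.
case=> Hl Hr; split=> [[|i] //|i] /=; last by rewrite nth_behead Hr.
exact: (Hl i).
Qed.

Lemma holds_dec t n : holds t n -> holds (move_left (write 0 t)) n.-1.
Proof.
case=> Hl Hr; split=> [[|i]|[|i]] //=.
- by have := Hl 1; rewrite /= nth0 => ->; case: n {Hl}.
- by have := Hl i.+2; rewrite /= nth_behead => ->; case: n {Hl}.
Qed.

Lemma work_tape_upd cf x f y st ip w :
  work_tape (Config st ip (update_tape cf x f) w) y =
  if y == x then f (work_tape cf x) else work_tape cf y.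
Proof. by rewrite /work_tape /update_tape /= nth_set_nth. Qed.

Lemma runs_skip u s i w : runs u Skip s i w s i w.
Proof.
move=> M o e cf /placed_cons[HM _] [Ho Hi Hw Ht]; exists 1.
by rewrite /= /step Ho HM if_same; split.
Qed.

Lemma runs_emit u b s i w : runs u (Emit b) s i w s i (rcons w b).
Proof.
move=> M o e cf /placed_cons[HM _] [Ho Hi Hw Ht]; exists 1.
by rewrite /= /step Ho HM; split=> //=; rewrite Hw.
Qed.

Lemma step_inc M u x e cf o s i w :
  nth Halt M o = MoveR x o.+1 -> nth Halt M o.+1 = Write x 1 e ->
  models cf o s i w ->
  models (iter 2 (step M u) cf) e (upd s x (s x).+1) i w.
Proof.
move=> H1 H2 [Ho Hi Hw Ht].
rewrite [iter 2 _ _]/= [step M u cf]/step Ho H1 /step [state _]/= H2.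
split=> // y; rewrite work_tape_upd work_tape_upd eqxx /upd.
case: (altP (y =P x)) => [_|neq]; first exact: holds_inc (Ht x).
by rewrite work_tape_upd (negPf neq); apply: Ht.
Qed.

Lemma runs_inc u x s i w : runs u (Inc x) s i w (upd s x (s x).+1) i w.
Proof.
move=> M o e cf /placed_cons[H1 /placed_cons[H2 _]] Hcf; exists 2.
exact: step_inc H1 H2 Hcf.
Qed.

Lemma upd_id s x : upd s x (s x) = s.
Proof. by apply: functional_extensionality => y; rewrite /upd; case: eqP => [->|]. Qed.

Lemma runs_dec u x s i w : runs u (Dec x) s i w (upd s x (s x).-1) i w.
Proof.
move=> M o e cf /placed_cons[H1 /placed_cons[H2 /placed_cons[H3 _]]] [Ho Hi Hw Ht].
have [s0|s0] := posnP (s x).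
  have -> : (s x).-1 = s x by rewrite s0.
  exists 1; rewrite upd_id /= /step Ho H1 (holds_scanned (Ht x)) s0 /=.
  by split.
exists 3; rewrite [iter 3 _ _]/= [step M u cf]/step Ho H1.
rewrite (holds_scanned (Ht x)) s0 /= [step M u (Config o.+1 _ _ _)]/step /= H2.
rewrite /step /= H3; split=> // y.
rewrite work_tape_upd work_tape_upd eqxx /upd.
case: (altP (y =P x)) => [_|neq]; first exact: holds_dec (Ht x).
by rewrite work_tape_upd (negPf neq); apply: Ht.
Qed.

Lemma runs_read u x s i w :
  runs u (ReadInc x) s i w (upd s x (s x + u i)) i.+1 w.
Proof.
move=> M o e cf /placed_cons[H1 /placed_cons[H2 /placed_cons[H3 _]]] [Ho Hi Hw Ht].
case ui: (u i); last first.
  by exists 1; rewrite /= /step Ho H1 Hi ui addn0 upd_id; split.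
exists 3; rewrite addn1 -[3]/(2 + 1) iterD; apply: (step_inc _ H2 H3).
by rewrite /= /step Ho H1 Hi ui.
Qed.

Arguments runs_skip : clear implicits.
Arguments runs_emit : clear implicits.
Arguments runs_dec : clear implicits.
Arguments runs_read : clear implicits.

Lemma runs_seq u c1 c2 s i w s1 i1 w1 s2 i2 w2 :
  runs u c1 s i w s1 i1 w1 -> runs u c2 s1 i1 w1 s2 i2 w2 ->
  runs u (Seq c1 c2) s i w s2 i2 w2.
Proof.
move=> H1 H2 M o e cf /placed_cat[]; rewrite size_compile => P1 P2 Hcf.
have [t1 {}Hcf] := H1 _ _ _ _ P1 Hcf; have [t2 Hcf2] := H2 _ _ _ _ P2 Hcf.
by exists (t2 + t1); rewrite iterD.
Qed.

Lemma models_test u M x e e' o cf s i w :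
  nth Halt M o = Test x 0 e e' -> models cf o s i w ->
  models (step M u cf) (if s x == 0 then e else e') s i w.
Proof.
move=> HM [Ho Hi Hw Ht]; rewrite /step Ho HM (holds_scanned (Ht x)) lt0n.
by split=> //=; case: (s x).
Qed.

Lemma runs_if u x c1 c2 s i w s' i' w' :
  runs u (if s x == 0 then c2 else c1) s i w s' i' w' ->
  runs u (If x c1 c2) s i w s' i' w'.
Proof.
move=> H M o e cf /placed_cons[HM /placed_cat[]]; rewrite size_compile => P1 P2.
move=> /(models_test u HM); case: eqP H => _ H.
  by move/(H _ _ _ _ P2) => [t Ht]; exists t.+1; rewrite iterSr.
by move/(H _ _ _ _ P1) => [t Ht]; exists t.+1; rewrite iterSr.
Qed.

(** A loop is specified by the stores S 0, ..., S n at its successive tests. *)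
Lemma runs_while u x c (S : nat -> store) n i w :
  (forall k, k < n -> S k x != 0 /\ runs u c (S k) i w (S k.+1) i w) ->
  S n x = 0 -> runs u (While x c) (S 0) i w (S n) i w.
Proof.
move=> Hstep Hend M o e cf /placed_cons[HM P] Hcf.
have: forall k, k <= n -> exists t, models (iter t (step M u) cf) o (S k) i w.
  elim=> [|k IH] ltk; first by exists 0.
  have [t Ht] := IH (ltnW ltk); have [Sk Hc] := Hstep k ltk.
  have := models_test u HM Ht; rewrite (negPf Sk) => {}Ht.
  have [t' Ht'] := Hc _ _ _ _ P Ht.
  by exists (t' + t.+1); rewrite iterD.
case/(_ n (leqnn n)) => t /(models_test u HM); rewrite Hend eqxx => Ht.
by exists t.+1.
Qed.

(** A record, so that its lemmas keep their store as an argument instead of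
    taking the machine and the configuration. *)
Record transforms (c : cmd) (s s' : store) : Prop := Transforms {
  transforms_runs : forall u i w, runs u c s i w s' i w }.

Lemma tr_seq c1 c2 s s1 s2 :
  transforms c1 s s1 -> transforms c2 s1 s2 -> transforms (Seq c1 c2) s s2.
Proof. by case=> H1 [H2]; split=> u i w; apply: runs_seq (H1 u i w) (H2 u i w). Qed.

Lemma tr_while x c (S : nat -> store) n s s' :
  (forall k, k < n -> S k x != 0 /\ transforms c (S k) (S k.+1)) ->
  S n x = 0 -> s = S 0 -> s' = S n -> transforms (While x c) s s'.
Proof.
move=> H H0 -> ->; split=> u i w; apply: runs_while H0 => k ltk.
by have [? []] := H k ltk.
Qed.

Lemma tr_eq c s s' s'' : transforms c s s' -> s'' = s' -> transforms c s s''.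
Proof. by move=> H ->. Qed.

Lemma tr_dec x s : transforms (Dec x) s (upd s x (s x).-1).
Proof. by split=> u i w; apply: runs_dec. Qed.
Lemma tr_inc x s : transforms (Inc x) s (upd s x (s x).+1).
Proof. by split=> u i w; apply: runs_inc. Qed.

Ltac lookup := rewrite /upd /=;
  repeat match goal with
    |- context [if ?a == ?b then _ else _] => case: (a =P b) => ?
  end; subst; try lia.

Ltac store := let y := fresh "y" in
  apply: functional_extensionality => y; lookup.

Definition clear x := While x (Dec x).

Lemma tr_clear x s : transforms (clear x) s (upd s x 0).
Proof.
apply: (@tr_while _ _ (fun k => upd s x (s x - k)) (s x)).
- move=> k ltk; split; first by lookup.
  by refine (tr_eq (tr_dec _ _) _); store.
- by rewrite /upd eqxx subnn.
- store.
- by rewrite subnn.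
Qed.

(** Counters can only be read by destroying them; a copy is made by moving a
    counter into two others and moving one of these back. *)
Definition move x y := While x (Seq (Dec x) (Inc y)).

Lemma tr_move x y s : x != y ->
  transforms (move x y) s (upd (upd s x 0) y (s y + s x)).
Proof.
move=> /eqP nxy.
apply: (@tr_while _ _ (fun k => upd (upd s x (s x - k)) y (s y + k)) (s x)).
- move=> k ltk; split; first by lookup.
  by refine (tr_eq (tr_seq (tr_dec _ _) (tr_inc _ _)) _); store.
- by lookup.
- store.
- store.
Qed.

Definition move2 x y z := While x (Seq (Dec x) (Seq (Inc y) (Inc z))).

Lemma tr_move2 x y z s : x != y -> x != z -> y != z ->
  transforms (move2 x y z) s
    (upd (upd (upd s x 0) y (s y + s x)) z (s z + s x)).
Proof.
move=> /eqP nxy /eqP nxz /eqP nyz.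
apply: (@tr_while _ _ (fun k =>
  upd (upd (upd s x (s x - k)) y (s y + k)) z (s z + k)) (s x)).
- move=> k ltk; split; first by lookup.
  refine (tr_eq (tr_seq (tr_dec _ _) (tr_seq (tr_inc _ _) (tr_inc _ _))) _).
  by store.
- by lookup.
- store.
- store.
Qed.

Definition copy x y z := Seq (move2 x y z) (move z x).

Lemma tr_copy x y z s : x != y -> x != z -> y != z -> s y = 0 -> s z = 0 ->
  transforms (copy x y z) s (upd s y (s x)).
Proof.
move=> nxy nxz nyz sy sz; have nzx : z != x by rewrite eq_sym.
refine (tr_eq (tr_seq (tr_move2 _ nxy nxz nyz) (tr_move _ nzx)) _).
move/eqP: nxy; move/eqP: nxz; move/eqP: nyz => ???; store.
Qed.

(** * Primitive recursive functions as counter programs *)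

Fixpoint tri n := if n is n'.+1 then tri n' + n else 0.

Lemma leq_tri m n : m <= n -> tri m <= tri n.
Proof. by move=> /subnK <-; elim: (n - m) => //= k; lia. Qed.

Definition cantor a b := a + tri (a + b).

(** One step along the diagonals that [cantor] numbers: the programs below pack
    and unpack pairs by walking along this path. *)
Definition cantor_next (ab : nat * nat) :=
  if ab.2 is b.+1 then (ab.1.+1, b) else (0, ab.1.+1).

Definition uncantor n := iter n cantor_next (0, 0).

Lemma cantorK a b : uncantor (cantor a b) = (a, b).
Proof.
move en: (cantor a b) => n; elim: n a b en => [|n IH] [|a] b.
- by case: b => // b; rewrite /cantor /=; lia.
- by rewrite /cantor; lia.
- case: b => // b; rewrite /cantor /= add0n => en.
  by rewrite -[LHS]/(cantor_next (uncantor n)) (IH b 0) // /cantor addn0; lia.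
move=> en; rewrite -[LHS]/(cantor_next (uncantor n)) (IH a b.+1) //.
by move: en; rewrite /cantor -(addSnnS a b); lia.
Qed.

Lemma leq_cantorr a b : b <= cantor a b.
Proof.
have le_tri n : n <= tri n by elim: n => //= n IH; lia.
by rewrite /cantor; have := le_tri (a + b); lia.
Qed.

(** Unary functions suffice because arguments are packed by [cantor].  [FIter f]
    takes a number of iterations paired with a starting value; parameters are
    carried along inside that value. *)
Inductive fn :=
| FId | FZero | FSucc | FPred | FLeft | FRight
| FPair (f g : fn)
| FComp (f g : fn)
| FIf (c f g : fn)
| FIter (f : fn).

Fixpoint eval (e : fn) (n : nat) : nat :=
  match e with
  | FId => n
  | FZero => 0
  | FSucc => n.+1
  | FPred => n.-1
  | FLeft => (uncantor n).1
  | FRight => (uncantor n).2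
  | FPair f g => cantor (eval f n) (eval g n)
  | FComp f g => eval f (eval g n)
  | FIf c f g => if eval c n == 0 then eval g n else eval f n
  | FIter f => iter (uncantor n).1 (eval f) (uncantor n).2
  end.

(** Walks n steps from (0, 0). *)
Definition unpair n a b :=
  While n (Seq (Dec n)
    (If b (Seq (Dec b) (Inc a)) (Seq (Inc b) (move a b)))).

(** Walks back to (0, 0), whole diagonals at a time: the first move goes back to
    the start of the diagonal, and each round of the loop then traverses the
    previous one. *)
Definition pairup a b n :=
  Seq (move2 a b n)
      (While b (Seq (Dec b) (Seq (Inc n) (Seq (move b a) (move2 a b n))))).

Lemma tr_if x c1 c2 s s' :
  (s x = 0 -> transforms c2 s s') -> (s x <> 0 -> transforms c1 s s') ->
  transforms (If x c1 c2) s s'.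
Proof.
move=> H1 H2; split=> u i w; apply: runs_if.
by case: eqP => [/H1 []|/H2 []] H; apply: H.
Qed.

Lemma tr_skip s : transforms Skip s s.
Proof. by split=> *; apply: runs_skip. Qed.

Lemma tr_unpair n a b s : n != a -> n != b -> a != b -> s a = 0 -> s b = 0 ->
  transforms (unpair n a b) s
    (upd (upd (upd s n 0) a (uncantor (s n)).1) b (uncantor (s n)).2).
Proof.
move=> nna nnb nab sa sb; have nba : b != a by rewrite eq_sym.
apply: (@tr_while _ _ (fun k =>
  upd (upd (upd s n (s n - k)) a (uncantor k).1) b (uncantor k).2) (s n)).
- move=> k ltk; move/eqP: (nna); move/eqP: (nnb); move/eqP: (nab) => ???.
  split; first by lookup.
  rewrite -[uncantor k.+1]/(cantor_next (uncantor k)); case: (uncantor k) => x y.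
  refine (tr_seq (tr_dec _ _) (tr_if _ _)).
  + move=> eb; have y0 : y = 0 by move: eb; lookup.
    rewrite y0; refine (tr_eq (tr_seq (tr_inc _ _) (tr_move _ nab)) _).
    by store.
  + move=> eb; have [z ez] : exists z, y = z.+1 by exists y.-1; move: eb; lookup.
    rewrite ez; refine (tr_eq (tr_seq (tr_dec _ _) (tr_inc _ _)) _).
    by store.
- by move/eqP: nna; move/eqP: nnb; move/eqP: nab => ???; lookup.
- by move/eqP: nna; move/eqP: nnb; move/eqP: nab => ???; store.
- by rewrite subnn.
Qed.

Lemma tr_pairup a b n s : n != a -> n != b -> a != b -> s n = 0 ->
  transforms (pairup a b n) s
    (upd (upd (upd s a 0) b 0) n (cantor (s a) (s b))).
Proof.
move=> nna nnb nab sn; have nba : b != a by rewrite eq_sym.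
have nan : a != n by rewrite eq_sym.
have nbn : b != n by rewrite eq_sym.
move/eqP: (nna); move/eqP: (nnb); move/eqP: (nab) => ???.
apply: tr_seq (tr_move2 _ nab nan nbn) _.
set m := s a + s b.
have tri_mono k : k <= m -> tri (m - k) <= tri m.
  by move=> lek; apply: leq_tri; lia.
apply: (@tr_while _ _ (fun k =>
  upd (upd (upd s a 0) b (m - k)) n (s a + (tri m - tri (m - k)))) m).
- move=> k ltk; split; first by lookup.
  refine (tr_eq (tr_seq (tr_dec _ _) (tr_seq (tr_inc _ _)
           (tr_seq (tr_move _ nba) (tr_move2 _ nab nan nbn)))) _).
  have := tri_mono k (ltnW ltk); have := tri_mono k.+1 ltk.
  have : tri (m - k) = tri (m - k.+1) + (m - k) by rewrite -subnSK //=.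
  move=> e1 e2 e3.
  by store.
- by lookup.
- by rewrite subn0 subnn addn0 sn /m (addnC (s b)).
- by rewrite subnn /cantor -/m /= subn0.
Qed.

(** Argument and result are in register [r]; the registers above [r] serve as a
    stack, empty before and after. *)
Fixpoint fcode (e : fn) (r : nat) : cmd :=
  match e with
  | FId => Skip
  | FZero => clear r
  | FSucc => Inc r
  | FPred => Dec r
  | FLeft => Seq (unpair r r.+1 r.+2) (Seq (move r.+1 r) (clear r.+2))
  | FRight => Seq (unpair r r.+1 r.+2) (Seq (move r.+2 r) (clear r.+1))
  | FPair f g =>
      Seq (copy r r.+1 r.+2) (Seq (fcode g r.+1)
        (Seq (copy r r.+2 r.+3) (Seq (fcode f r.+2)
          (Seq (clear r) (pairup r.+2 r.+1 r)))))
  | FComp f g => Seq (fcode g r) (fcode f r)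
  | FIf c f g =>
      Seq (copy r r.+1 r.+2) (Seq (fcode c r.+1)
        (If r.+1 (Seq (clear r.+1) (fcode f r)) (fcode g r)))
  | FIter f =>
      Seq (unpair r r.+1 r.+2) (Seq
        (While r.+1 (Seq (Dec r.+1) (fcode f r.+2))) (move r.+2 r))
  end.

Lemma tr_fcode e r s : (forall x, r < x -> s x = 0) ->
  transforms (fcode e r) s (upd s r (eval e (s r))).
Proof.
elim: e r s => [||||||f IHf g IHg|f IHf g IHg|c IHc f IHf g IHg|f IHf] r s hs;
  have s1 : s r.+1 = 0 by [apply: hs|]; have s2 : s r.+2 = 0 by [apply: hs; lia|];
  have n01 : r != r.+1 by [lia|]; have n02 : r != r.+2 by [lia|];
  have n12 : r.+1 != r.+2 by [lia|]; have n10 : r.+1 != r by [lia|];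
  have n20 : r.+2 != r by [lia|]; rewrite /=.
- by rewrite upd_id; apply: tr_skip.
- exact: tr_clear.
- exact: tr_inc.
- exact: tr_dec.
- refine (tr_eq (tr_seq (tr_unpair n01 n02 n12 s1 s2)
                  (tr_seq (tr_move _ n10) (tr_clear _ _))) _).
  by store.
- refine (tr_eq (tr_seq (tr_unpair n01 n02 n12 s1 s2)
                  (tr_seq (tr_move _ n20) (tr_clear _ _))) _).
  by store.
- refine (tr_eq (tr_seq (tr_copy n01 n02 n12 s1 s2) (tr_seq (IHg _ _ _) _)) _).
    by move=> x ltx; have := hs x; lookup.
  have n03 : r != r.+3 by lia.
  have n23 : r.+2 != r.+3 by lia.
  refine (tr_seq (tr_copy n02 n03 n23 _ _) (tr_seq (IHf _ _ _) _)).
  + by lookup.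
  + by have := hs r.+3; lookup.
  + by move=> x ltx; have := hs x; lookup.
  have n21 : r.+2 != r.+1 by lia.
  refine (tr_seq (tr_clear _ _) (tr_pairup n02 n01 n21 _)).
  by lookup.
  by store.
- refine (tr_eq (tr_seq (IHg _ _ hs) (IHf _ _ _)) _).
    by move=> x ltx; have := hs x; lookup.
  by store.
- refine (tr_seq (tr_copy n01 n02 n12 s1 s2) (tr_seq (IHc _ _ _) _)).
    by move=> x ltx; have := hs x; lookup.
  refine (tr_if _ _).
  + move=> ec; refine (tr_eq (IHg _ _ _) _).
      by move=> x ltx; have := hs x; move: ec; lookup.
    have {}ec : eval c (s r) = 0 by move: ec; lookup.
    by rewrite ec eqxx; store.
  + move=> ec; refine (tr_eq (tr_seq (tr_clear _ _) (IHf _ _ _)) _).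
      by move=> x ltx; have := hs x; lookup.
    have /eqP/negPf -> : eval c (s r) <> 0 by move: ec; lookup.
    by store.
- refine (tr_seq (tr_unpair n01 n02 n12 s1 s2) _).
  case: (uncantor (s r)) => k a /=.
  suff loop : transforms (While r.+1 (Seq (Dec r.+1) (fcode f r.+2)))
      (upd (upd (upd s r 0) r.+1 k) r.+2 a)
      (upd (upd (upd s r 0) r.+1 0) r.+2 (iter k (eval f) a)).
    by refine (tr_eq (tr_seq loop (tr_move _ n20)) _); store.
  apply: (@tr_while _ _ (fun j =>
    upd (upd (upd s r 0) r.+1 (k - j)) r.+2 (iter j (eval f) a)) k).
  + move=> j ltj; split; first by lookup.
    refine (tr_eq (tr_seq (tr_dec _ _) (IHf _ _ _)) _).
      by move=> x ltx; have := hs x; lookup.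
    by store.
  + by lookup.
  + by rewrite subn0.
  + by rewrite subnn.
Qed.

(** * Transducers *)

Definition emitted (v : nat) : seq bool :=
  match v with 0 => [::] | 1 => [:: false] | _ => [:: true] end.

(** Register 0 holds the state.  A round reads one bit, updates the state by the
    function for that bit, and emits at most one bit, as a third function of the
    new state commands. *)
Definition round (f0 f1 g : fn) : cmd :=
  Seq (ReadInc 1)
  (Seq (If 1 (Seq (Dec 1) (fcode f1 0)) (fcode f0 0))
  (Seq (copy 0 1 2)
  (Seq (fcode g 1)
       (If 1 (Seq (Dec 1) (If 1 (Seq (clear 1) (Emit true)) (Emit false)))
             Skip)))).

Definition reg0 (x : nat) : store := upd (fun=> 0) 0 x.

Lemma runs_eq u c s i w s' i' w' s'' :
  runs u c s i w s' i' w' -> s'' = s' -> runs u c s i w s'' i' w'.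
Proof. by move=> H ->. Qed.

Lemma runs_round u f0 f1 g x i w (x' := eval (if u i then f1 else f0) x) :
  runs u (round f0 f1 g) (reg0 x) i w (reg0 x') i.+1 (w ++ emitted (eval g x')).
Proof.
apply: runs_seq (runs_read _ _ _ _ _) _.
apply: (@runs_seq _ _ _ _ _ _ (reg0 x') i.+1 w).
  apply: transforms_runs; rewrite /x' /reg0; case ui: (u i); apply: tr_if => //.
  - move=> _; refine (tr_eq (tr_seq (tr_dec _ _) (tr_fcode f1 _)) _).
      by case=> [|[|y]].
    by store.
  - move=> _; refine (tr_eq (tr_fcode f0 _) _); first by case=> [|[|y]].
    by store.
pose s1 := upd (reg0 x') 1 x'; pose s2 := upd (reg0 x') 1 (eval g x').
apply: (@runs_seq _ _ _ _ _ _ s1 i.+1 w).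
  by apply: transforms_runs; apply: tr_copy.
apply: (@runs_seq _ _ _ _ _ _ s2 i.+1 w).
  apply: transforms_runs; refine (tr_eq (tr_fcode g _) _); first by case=> [|[|y]].
  by rewrite /s1 /s2; store.
apply: runs_if; rewrite /s2 [upd _ 1 _ 1]/=; case: (eval g x') => [|[|v]] /=.
- by rewrite cats0; apply: runs_eq (runs_skip _ _ _ _) _; rewrite /reg0; store.
- apply: runs_seq (runs_dec _ _ _ _ _) _; apply: runs_if; rewrite /= cats1.
  by apply: runs_eq (runs_emit _ _ _ _ _) _; rewrite /reg0; store.
- apply: runs_seq (runs_dec _ _ _ _ _) _; apply: runs_if; rewrite /= cats1.
  apply: runs_seq (@transforms_runs _ _ _ (tr_clear _ _) _ _ _) _.
  by apply: runs_eq (runs_emit _ _ _ _ _) _; rewrite /reg0; store.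
Qed.

(** The exit of the round is its own start, so the machine loops forever. *)
Definition transducer (f0 f1 g : fn) : machine := compile (round f0 f1 g) 0 0.

Fixpoint transducer_state (u : nat -> bool) (f0 f1 : fn) (n : nat) : nat :=
  if n is n'.+1 then eval (if u n' then f1 else f0) (transducer_state u f0 f1 n') else 0.

Definition transduced u f0 f1 g n : seq bool :=
  flatten (mkseq (fun k => emitted (eval g (transducer_state u f0 f1 k.+1))) n).

Lemma run_transducer u f0 f1 g n :
  exists t, output (run (transducer f0 f1 g) u t) = transduced u f0 f1 g n.
Proof.
suff [t [_ _ <- _]] : exists t, models (run (transducer f0 f1 g) u t)
    0 (reg0 (transducer_state u f0 f1 n)) n (transduced u f0 f1 g n) by exists t.
elim: n => [|n [t Ht]].
  exists 0; split=> // x; rewrite /work_tape nth_nil /reg0 /upd /= if_same.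
  by split=> [[|[|i]]|[|i]].
have P : placed (transducer f0 f1 g) 0 (compile (round f0 f1 g) 0 0) by [].
have [t' Ht'] := @runs_round u f0 f1 g _ _ _ _ _ _ _ P Ht.
exists (t' + t); rewrite /run iterD.
by rewrite /transduced mkseqS -cats1 flatten_cat /= cats0.
Qed.

(** * Primitive recursion on encoded types *)

Class Enc (T : Type) := enc : T -> nat.

#[local] Instance enc_nat : Enc nat := id.
#[local] Instance enc_bool : Enc bool := nat_of_bool.
#[local] Instance enc_prod (T U : Type) (eT : Enc T) (eU : Enc U) : Enc (T * U) :=
  fun x => cantor (enc x.1) (enc x.2).
#[local] Instance enc_seq (T : Type) (eT : Enc T) : Enc (seq T) :=
  foldr (fun x n => (cantor (enc x) n).+1) 0.

(** Since [e] may take any value on numbers that are not codes, [enc] needs no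
    computable inverse. *)
Definition primrec (T U : Type) (eT : Enc T) (eU : Enc U) (f : T -> U) : Prop :=
  exists e, forall x, eval e (enc x) = enc (f x).
Arguments primrec {T U eT eU} f.

(* [pr_rule] is redefined below each time new closure lemmas are available.  The
   search never backtracks: the head symbol of the goal determines the rule. *)
Ltac pr_rule := fail.
Ltac pr_hyp := fail.
Ltac pr := repeat (cbn beta; first [assumption | pr_rule | pr_hyp]).

Lemma pr_ext T U (eT : Enc T) (eU : Enc U) (f g : T -> U) :
  primrec f -> f =1 g -> primrec g.
Proof. by case=> e He fg; exists e => x; rewrite He fg. Qed.

Lemma pr_comp T U V (eT : Enc T) (eU : Enc U) (eV : Enc V)
  (g : U -> V) (f : T -> U) :
  primrec g -> primrec f -> primrec (fun x => g (f x)).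
Proof. by case=> eg Hg [ef Hf]; exists (FComp eg ef) => x /=; rewrite Hf Hg. Qed.

Ltac pr_hyp ::=
  match goal with H : primrec ?h |- primrec (fun x => ?h (@?g x)) =>
    simple apply (pr_comp (f := g) H) end.

Lemma pr_id T (eT : Enc T) : primrec (fun x : T => x).
Proof. by exists FId. Qed.

Lemma pr_const T U (eT : Enc T) (eU : Enc U) (c : U) : primrec (fun _ : T => c).
Proof.
exists (iter (enc c) (FComp FSucc) FZero) => x.
by elim: (enc c) => //= n ->.
Qed.

Lemma pr_pair X (eX : Enc X) T U (eT : Enc T) (eU : Enc U) (f : X -> T) (g : X -> U) :
  primrec f -> primrec g -> primrec (fun x => (f x, g x)).
Proof. by case=> ef Hf [eg Hg]; exists (FPair ef eg) => x /=; rewrite Hf Hg. Qed.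

Lemma pr_fst X (eX : Enc X) T U (eT : Enc T) (eU : Enc U) (f : X -> T * U) :
  primrec f -> primrec (fun x => (f x).1).
Proof. by case=> ef Hf; exists (FComp FLeft ef) => x /=; rewrite Hf cantorK. Qed.

Lemma pr_snd X (eX : Enc X) T U (eT : Enc T) (eU : Enc U) (f : X -> T * U) :
  primrec f -> primrec (fun x => (f x).2).
Proof. by case=> ef Hf; exists (FComp FRight ef) => x /=; rewrite Hf cantorK. Qed.

Lemma pr_succ X (eX : Enc X) (f : X -> nat) : primrec f -> primrec (fun x => (f x).+1).
Proof. by case=> ef Hf; exists (FComp FSucc ef) => x /=; rewrite Hf. Qed.

Lemma pr_pred X (eX : Enc X) (f : X -> nat) : primrec f -> primrec (fun x => (f x).-1).
Proof. by case=> ef Hf; exists (FComp FPred ef) => x /=; rewrite Hf. Qed.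

Lemma pr_eq0 X (eX : Enc X) (f : X -> nat) : primrec f -> primrec (fun x => f x == 0).
Proof.
case=> e He; exists (FIf e FZero (FComp FSucc FZero)) => x /=.
by rewrite He /enc /enc_nat /=; case: (f x).
Qed.

Lemma pr_if X (eX : Enc X) T (eT : Enc T) (b : X -> bool) (f g : X -> T) :
  primrec b -> primrec f -> primrec g ->
  primrec (fun x => if b x then f x else g x).
Proof.
case=> eb Hb [ef Hf] [eg Hg]; exists (FIf eb ef eg) => x /=.
by rewrite Hb Hf Hg; case: (b x).
Qed.

Lemma pr_iter X (eX : Enc X) T (eT : Enc T)
    (n : X -> nat) (f : X -> T -> T) (a : X -> T) :
  primrec n -> primrec (fun z : X * T => f z.1 z.2) -> primrec a ->
  primrec (fun x => iter (n x) (f x) (a x)).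
Proof.
case=> en Hn [ef Hf] [ea Ha].
(* The iterated value is a pair whose first half keeps the code of x. *)
exists (FComp FRight
  (FComp (FIter (FPair FLeft ef)) (FPair en (FPair FId ea)))) => x /=.
rewrite cantorK Hn Ha /= {1}/enc /enc_nat.
suff -> : iter (n x) (eval (FPair FLeft ef)) (cantor (eX x) (eT (a x))) =
  cantor (eX x) (eT (iter (n x) (f x) (a x))) by rewrite cantorK.
elim: (n x) => //= k ->; rewrite cantorK /=; congr cantor.
exact: (Hf (x, _)).
Qed.

Lemma pr_cons X (eX : Enc X) T (eT : Enc T) (f : X -> T) (g : X -> seq T) :
  primrec f -> primrec g -> primrec (fun x => f x :: g x).
Proof.
by case=> ef Hf [eg Hg]; exists (FComp FSucc (FPair ef eg)) => x /=; rewrite Hf Hg.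
Qed.

Lemma pr_case X (eX : Enc X) T U (eT : Enc T) (eU : Enc U)
    (l : X -> seq T) (n : X -> U) (c : X -> T -> seq T -> U) :
  primrec l -> primrec n ->
  primrec (fun z : X * (T * seq T) => c z.1 z.2.1 z.2.2) ->
  primrec (fun x => if l x is y :: l' then c x y l' else n x).
Proof.
case=> el Hl [en Hn] [ec Hc].
exists (FIf el (FComp ec (FPair FId (FComp FPred el))) en) => x /=.
rewrite Hl Hn; case: (l x) => [//|y l'] /=.
exact: (Hc (x, (y, l'))).
Qed.

Lemma primrec_fst T U (eT : Enc T) (eU : Enc U) : primrec (@fst T U).
Proof. exact: (pr_fst (pr_id _)). Qed.

Lemma primrec_snd T U (eT : Enc T) (eU : Enc U) : primrec (@snd T U).
Proof. exact: (pr_snd (pr_id _)). Qed.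

Ltac pr_basic := first
  [ simple eapply pr_id | simple eapply pr_const | simple eapply pr_pair
  | simple eapply primrec_fst | simple eapply primrec_snd
  | simple eapply pr_fst | simple eapply pr_snd | simple eapply pr_succ
  | simple eapply pr_pred | simple eapply pr_eq0 | simple eapply pr_if
  | simple eapply pr_iter | simple eapply pr_cons | simple eapply pr_case ].
Ltac pr_rule ::= pr_basic.

Lemma pr_comp2 X A B T (eX : Enc X) (eA : Enc A) (eB : Enc B) (eT : Enc T)
    (f : A -> B -> T) (a : X -> A) (b : X -> B) :
  primrec (fun z : A * B => f z.1 z.2) -> primrec a -> primrec b ->
  primrec (fun x => f (a x) (b x)).
Proof.
move=> Hf Ha Hb; apply: (@pr_comp _ _ _ _ _ _ _ (fun x => (a x, b x)) Hf); pr.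
Qed.

Lemma pr_comp3 X A B C T (eX : Enc X) (eA : Enc A) (eB : Enc B) (eC : Enc C)
    (eT : Enc T) (f : A -> B -> C -> T) (a : X -> A) (b : X -> B) (c : X -> C) :
  primrec (fun z : A * (B * C) => f z.1 z.2.1 z.2.2) ->
  primrec a -> primrec b -> primrec c ->
  primrec (fun x => f (a x) (b x) (c x)).
Proof.
move=> Hf Ha Hb Hc.
apply: (@pr_comp _ _ _ _ _ _ _ (fun x => (a x, (b x, c x))) Hf); pr.
Qed.

Lemma size_le_enc T (eT : Enc T) (l : seq T) : size l <= enc l.
Proof.
elim: l => //= x l IH; rewrite ltnS.
exact: leq_trans IH (leq_cantorr _ _).
Qed.

(** A fold is an iteration that eats the list.  The code of the list bounds its
    length, and further iterations change nothing once the list is empty. *)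
Lemma pr_foldl X (eX : Enc X) T U (eT : Enc T) (eU : Enc U) (f : X -> T -> U -> T)
    (a : X -> T) (l : X -> seq U) :
  primrec (fun z : X * (T * U) => f z.1 z.2.1 z.2.2) -> primrec a ->
  primrec l -> primrec (fun x => foldl (f x) (a x) (l x)).
Proof.
move=> Hf Ha Hl.
pose F x (s : T * seq U) := if s.2 is y :: l' then (f x s.1 y, l') else s.
have Hn : primrec (fun x => enc (l x)) by exact: Hl.
apply: (@pr_ext _ _ _ _ (fun x => (iter (enc (l x)) (F x) (a x, l x)).1)); last first.
  move=> x.
  have := @size_le_enc U eU (l x); move: (enc (l x)) => n.
  elim: n (l x) (a x) => [|n IH] l' c; first by rewrite leqn0 => /nilP ->.
  by case: l' => [|y l'] lel; rewrite iterSr; apply: IH.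
apply: pr_fst; apply: pr_iter => //; last by pr.
by rewrite /F; pr; apply: (pr_comp3 Hf); pr.
Qed.

Lemma pr_add X (eX : Enc X) (f g : X -> nat) :
  primrec f -> primrec g -> primrec (fun x => f x + g x).
Proof.
move=> Hf Hg; apply: (@pr_ext _ _ _ _ (fun x => iter (f x) succn (g x))).
  by apply: pr_iter; pr.
by move=> x; rewrite iter_succn addnC.
Qed.

Lemma pr_sub X (eX : Enc X) (f g : X -> nat) :
  primrec f -> primrec g -> primrec (fun x => f x - g x).
Proof.
move=> Hf Hg; apply: (@pr_ext _ _ _ _ (fun x => iter (g x) predn (f x))).
  by apply: pr_iter; pr.
by move=> x; rewrite iter_predn.
Qed.

Lemma pr_leq X (eX : Enc X) (f g : X -> nat) :
  primrec f -> primrec g -> primrec (fun x => f x <= g x).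
Proof. by move=> Hf Hg; apply: pr_eq0; apply: pr_sub. Qed.

Lemma pr_and X (eX : Enc X) (f g : X -> bool) :
  primrec f -> primrec g -> primrec (fun x => f x && g x).
Proof. by move=> Hf Hg; rewrite /andb; pr. Qed.

Lemma pr_or X (eX : Enc X) (f g : X -> bool) :
  primrec f -> primrec g -> primrec (fun x => f x || g x).
Proof. by move=> Hf Hg; rewrite /orb; pr. Qed.

Lemma pr_neg X (eX : Enc X) (f : X -> bool) : primrec f -> primrec (fun x => ~~ f x).
Proof. by move=> Hf; rewrite /negb; pr. Qed.

Lemma pr_eqn X (eX : Enc X) (f g : X -> nat) :
  primrec f -> primrec g -> primrec (fun x => f x == g x).
Proof.
move=> Hf Hg.
apply: (@pr_ext _ _ _ _ (fun x => (f x <= g x) && (g x <= f x))).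
  by apply: pr_and; apply: pr_leq.
by move=> x; rewrite -eqn_leq.
Qed.

Lemma pr_double X (eX : Enc X) (f : X -> nat) : primrec f -> primrec (fun x => (f x).*2).
Proof.
move=> Hf; apply: (@pr_ext _ _ _ _ (fun x => f x + f x)); first exact: pr_add.
by move=> x; rewrite addnn.
Qed.

Ltac pr_arith := first
  [ pr_basic | simple eapply pr_add | simple eapply pr_sub
  | simple eapply pr_leq | simple eapply pr_and | simple eapply pr_or
  | simple eapply pr_neg | simple eapply pr_eqn | simple eapply pr_double ].
Ltac pr_rule ::= pr_arith.

Lemma pr_odd X (eX : Enc X) (f : X -> nat) : primrec f -> primrec (fun x => odd (f x)).
Proof.
move=> Hf; apply: (@pr_ext _ _ _ _ (fun x => iter (f x) negb false)).
  by pr.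
by move=> x; elim: (f x) => //= n ->.
Qed.

(** The iterated pair consists of the lower and the upper half of the number of
    steps made so far; each step exchanges them and increments one. *)
Lemma pr_half X (eX : Enc X) (f : X -> nat) : primrec f -> primrec (fun x => (f x)./2).
Proof.
move=> Hf; apply: (@pr_ext _ _ _ _ (fun x =>
  (iter (f x) (fun s => (s.2, s.1.+1)) (0, 0)).1)); first by pr.
move=> x; suff -> : iter (f x) (fun s => (s.2, s.1.+1)) (0, 0) =
  ((f x)./2, uphalf (f x)) by [].
by elim: (f x) => //= n ->; rewrite uphalf_half.
Qed.

Lemma pr_rev X T (eX : Enc X) (eT : Enc T) (l : X -> seq T) :
  primrec l -> primrec (fun x => rev (l x)).
Proof.
move=> Hl; apply: (@pr_ext _ _ _ _ (fun x => foldl (fun a y => y :: a) [::] (l x))).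
  by apply: pr_foldl; pr.
move=> x; rewrite /rev; elim: (l x) [::] => //= *; auto.
Qed.

Lemma pr_rcons X T (eX : Enc X) (eT : Enc T) (l : X -> seq T) (f : X -> T) :
  primrec l -> primrec f -> primrec (fun x => rcons (l x) (f x)).
Proof.
move=> Hl Hf; apply: (@pr_ext _ _ _ _ (fun x => rev (f x :: rev (l x)))).
  by apply: pr_rev; apply: pr_cons Hf _; apply: pr_rev.
by move=> x; rewrite rev_cons revK.
Qed.

Lemma pr_foldr X T (eX : Enc X) (eT : Enc T) U (eU : Enc U)
    (f : X -> T -> U -> U) (a : X -> U) (l : X -> seq T) :
  primrec (fun z : X * (T * U) => f z.1 z.2.1 z.2.2) -> primrec a ->
  primrec l -> primrec (fun x => foldr (f x) (a x) (l x)).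
Proof.
move=> Hf Ha Hl.
apply: (@pr_ext _ _ _ _ (fun x => foldl (fun b y => f x y b) (a x) (rev (l x)))).
  by apply: pr_foldl Ha _; [apply: (pr_comp3 Hf); pr | apply: pr_rev].
by move=> x; rewrite foldl_rev.
Qed.

Lemma pr_size X T (eX : Enc X) (eT : Enc T) (l : X -> seq T) :
  primrec l -> primrec (fun x => size (l x)).
Proof.
move=> Hl; apply: (@pr_ext _ _ _ _ (fun x => foldr (fun _ => succn) 0 (l x))).
  by apply: pr_foldr; pr.
by move=> x; elim: (l x) => //= ? ? ->.
Qed.

Lemma pr_behead X T (eX : Enc X) (eT : Enc T) (l : X -> seq T) :
  primrec l -> primrec (fun x => behead (l x)).
Proof. by move=> Hl; rewrite /behead; apply: pr_case; pr. Qed.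

Lemma pr_head X T (eX : Enc X) (eT : Enc T) (d : X -> T) (l : X -> seq T) :
  primrec d -> primrec l -> primrec (fun x => head (d x) (l x)).
Proof. by move=> Hd Hl; rewrite /head; apply: pr_case; pr. Qed.

Lemma pr_nth X T (eX : Enc X) (eT : Enc T) (d : X -> T) (l : X -> seq T) (i : X -> nat) :
  primrec d -> primrec l -> primrec i -> primrec (fun x => nth (d x) (l x) (i x)).
Proof.
move=> Hd Hl Hi.
apply: (@pr_ext _ _ _ _ (fun x => head (d x) (iter (i x) behead (l x)))).
  by apply: pr_head => //; apply: pr_iter => //; apply: pr_behead; pr.
by move=> x; elim: (i x) (l x) => [|n IH] [|y l'] //; rewrite iterSr IH ?nth_nil.
Qed.

Lemma pr_mkseq X T (eX : Enc X) (eT : Enc T) (f : X -> nat -> T) (n : X -> nat) :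
  primrec (fun z : X * nat => f z.1 z.2) -> primrec n ->
  primrec (fun x => mkseq (f x) (n x)).
Proof.
move=> Hf Hn.
apply: (@pr_ext _ _ _ _ (fun x => rev (iter (n x) (fun s => f x (size s) :: s) [::]))).
  by apply: pr_rev; pr; apply: (pr_comp2 Hf); pr; apply: pr_size; pr.
move=> x; apply: canLR (@revK _) _.
elim: (n x) => //= k ->; rewrite mkseqS rev_rcons.
by rewrite size_rev size_mkseq.
Qed.

Ltac pr_seq := first
  [ pr_arith | simple eapply pr_odd | simple eapply pr_half
  | simple eapply pr_foldl | simple eapply pr_foldr | simple eapply pr_rev
  | simple eapply pr_rcons | simple eapply pr_size | simple eapply pr_behead
  | simple eapply pr_head | simple eapply pr_nth | simple eapply pr_mkseq ].
Ltac pr_rule ::= pr_seq.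

Lemma pr_set_nth X T (eX : Enc X) (eT : Enc T) (d : T)
    (l : X -> seq T) (i : X -> nat) (y : X -> T) :
  primrec l -> primrec i -> primrec y ->
  primrec (fun x => set_nth d (l x) (i x) (y x)).
Proof.
move=> Hl Hi Hy.
apply: (@pr_ext _ _ _ _ (fun x => mkseq
  (fun k => if k == i x then y x else nth d (l x) k)
  ((i x).+1 + (size (l x) - (i x).+1)))).
  by pr.
move=> x; apply: (@eq_from_nth _ d).
  by rewrite size_mkseq size_set_nth maxnE.
rewrite size_mkseq => k ltk; rewrite nth_mkseq // nth_set_nth /=.
by case: eqP.
Qed.

(** * Simulating Turing machines by a primitive recursive function *)

#[local] Instance enc_tape : Enc tape := fun t => enc (lcells t, (scanned t, rcells t)).
#[local] Instance enc_config : Enc config :=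
  fun c => enc ((state c, input_pos c), (work c, output c)).

Lemma pr_Tape X (eX : Enc X) (l : X -> seq nat) (a : X -> nat) (r : X -> seq nat) :
  primrec l -> primrec a -> primrec r -> primrec (fun x => Tape (l x) (a x) (r x)).
Proof. by move=> Hl Ha Hr; apply: (pr_pair Hl (pr_pair Ha Hr)). Qed.

Lemma pr_Config X (eX : Enc X) (s i : X -> nat) (ts : X -> seq tape) (o : X -> seq bool) :
  primrec s -> primrec i -> primrec ts -> primrec o ->
  primrec (fun x => Config (s x) (i x) (ts x) (o x)).
Proof. by move=> Hs Hi Ht Ho; apply: (pr_pair (pr_pair Hs Hi) (pr_pair Ht Ho)). Qed.

Lemma primrec_lcells : primrec lcells.
Proof. by exists (FLeft) => -[*]; rewrite /= /enc_tape /= !cantorK. Qed.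

Lemma primrec_scanned : primrec scanned.
Proof. by exists (FComp FLeft FRight) => -[*]; rewrite /= /enc_tape /= !cantorK. Qed.

Lemma primrec_rcells : primrec rcells.
Proof. by exists (FComp FRight FRight) => -[*]; rewrite /= /enc_tape /= !cantorK. Qed.

Lemma primrec_state : primrec state.
Proof. by exists (FComp FLeft FLeft) => -[*]; rewrite /= /enc_config /= !cantorK. Qed.

Lemma primrec_input_pos : primrec input_pos.
Proof. by exists (FComp FRight FLeft) => -[*]; rewrite /= /enc_config /= !cantorK. Qed.

Lemma primrec_work : primrec work.
Proof. by exists (FComp FLeft FRight) => -[*]; rewrite /= /enc_config /= !cantorK. Qed.

Lemma primrec_output : primrec output.
Proof. by exists (FComp FRight FRight) => -[*]; rewrite /= /enc_config /= !cantorK. Qed.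

Ltac pr_field :=
  match goal with
  | |- primrec (fun x => lcells (@?t x)) => simple apply (pr_comp (f := t) primrec_lcells)
  | |- primrec (fun x => scanned (@?t x)) => simple apply (pr_comp (f := t) primrec_scanned)
  | |- primrec (fun x => rcells (@?t x)) => simple apply (pr_comp (f := t) primrec_rcells)
  | |- primrec (fun x => state (@?c x)) => simple apply (pr_comp (f := c) primrec_state)
  | |- primrec (fun x => input_pos (@?c x)) =>
      simple apply (pr_comp (f := c) primrec_input_pos)
  | |- primrec (fun x => work (@?c x)) => simple apply (pr_comp (f := c) primrec_work)
  | |- primrec (fun x => output (@?c x)) => simple apply (pr_comp (f := c) primrec_output)
  end.
Ltac pr_machine := first
  [ pr_seq | simple eapply pr_set_nth | simple eapply pr_Tape
  | simple eapply pr_Config | pr_field ].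
Ltac pr_rule ::= pr_machine.

(** One step of a machine on the code of its current instruction.  The code is
    inspected by its length and its entries, as these are already known to be
    primitive recursive. *)
Definition exec (l : seq nat) (b : bool) (c : config) : config :=
  if (size l == 3) && (nth 0 l 0 == 0) then
    Config (nth 0 l 2) (input_pos c) (update_tape c (nth 0 l 1) move_left) (output c)
  else if (size l == 3) && (nth 0 l 0 == 1) then
    Config (nth 0 l 2) (input_pos c) (update_tape c (nth 0 l 1) move_right) (output c)
  else if (size l == 4) && (nth 0 l 0 == 2) then
    Config (nth 0 l 3) (input_pos c)
           (update_tape c (nth 0 l 1) (write (nth 0 l 2))) (output c)
  else if (size l == 5) && (nth 0 l 0 == 3) then
    Config (if scanned (work_tape c (nth 0 l 1)) == nth 0 l 2
            then nth 0 l 3 else nth 0 l 4)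
           (input_pos c) (work c) (output c)
  else if (size l == 3) && (nth 0 l 0 == 4) then
    Config (if b then nth 0 l 2 else nth 0 l 1)
           (input_pos c).+1 (work c) (output c)
  else if (size l == 3) && (nth 0 l 0 == 5) then
    Config (nth 0 l 2) (input_pos c) (work c) (rcons (output c) (nth 0 l 1 != 0))
  else c.

Lemma step_exec n u c :
  step (nth_machine n) u c =
  exec (CodeSeq.decode (nth 0 (CodeSeq.decode n) (state c))) (u (input_pos c)) c.
Proof.
rewrite /step /nth_machine.
have -> : forall s i, nth Halt [seq decode_instr (CodeSeq.decode m) | m <- s] i =
    decode_instr (CodeSeq.decode (nth 0 s i)) by elim=> [|m s IH] [|i] //=.
case: (CodeSeq.decode (nth _ _ _)) => [//|k l].
by case: k => [|[|[|[|[|[|k]]]]]]; case: l => [|a1 [|a2 [|a3 [|a4 [|a5 l]]]]].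
Qed.

Lemma pr_exec X (eX : Enc X) (l : X -> seq nat) (b : X -> bool) (c : X -> config) :
  primrec l -> primrec b -> primrec c ->
  primrec (fun x => exec (l x) (b x) (c x)).
Proof.
move=> Hl Hb Hc.
rewrite /exec /update_tape /move_left /move_right /write /work_tape /negb.
by pr.
Qed.

(** The state consists of the list decoded so far (in reverse), and the three
    arguments v, q and r of [CodeSeq.decode_rec].  That function recurs on q,
    which decreases by one at each call, so starting from q = n - 1 it takes
    exactly n steps. *)
Definition decode_step (s : (seq nat * nat) * (nat * nat)) :=
  if s.2.1 == 0 then ((s.1.2 :: s.1.1, 0), (0, 0))
  else if s.2.2 == 0 then ((s.1.2 :: s.1.1, 0), (s.2.1.-1, s.2.1.-1))
  else if s.2.2 == 1 then ((s.1.1, s.1.2.+1), (s.2.1.-1, s.2.1.-1))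
  else ((s.1.1, s.1.2), (s.2.1.-1, s.2.2.-2)).

Lemma decodeE n :
  CodeSeq.decode n = rev (iter n decode_step (([::], 0), (n.-1, n.-1))).1.1.
Proof.
case: n => // n; rewrite /CodeSeq.decode /=-/(iter _ _ _).
suff H q : forall r v acc, (iter q.+1 decode_step ((acc, v), (q, r))).1.1 =
  catrev (CodeSeq.decode_rec v q r) acc.
  by rewrite -[X in rev X.1.1]/(iter n.+1 _ _) H /rev catrevE cats0 revK.
elim: q => [|q IH] r v acc; first by case: r.
rewrite iterSr; case: r => [|[|r]]; by rewrite /decode_step /= IH.
Qed.

Lemma pr_decode X (eX : Enc X) (n : X -> nat) :
  primrec n -> primrec (fun x => CodeSeq.decode (n x)).
Proof.
move=> Hn; apply: (@pr_ext _ _ _ _ (fun x =>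
  rev (iter (n x) decode_step (([::], 0), ((n x).-1, (n x).-1))).1.1)).
  by rewrite /decode_step; pr.
by move=> x; rewrite decodeE.
Qed.

(** Incremental parsing of a unary tape: the completed blocks, latest first, and
    the number of ones since the last separator. *)
Definition feed (s : seq nat * nat) (b : bool) : seq nat * nat :=
  if b then (s.1, s.2.+1) else (s.2 :: s.1, 0).

Definition blocks (w : seq bool) : seq nat := rev (foldl feed ([::], 0) w).1.

Definition unary_seq (l : seq nat) : seq bool :=
  flatten [seq rcons (nseq x true) false | x <- l].

Lemma unary_prefixE p k : unary_prefix p k = unary_seq (mkseq p k).
Proof. by rewrite /unary_seq -map_comp. Qed.

Lemma unary_seq_cat l l' : unary_seq (l ++ l') = unary_seq l ++ unary_seq l'.
Proof. by rewrite /unary_seq map_cat flatten_cat. Qed.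

Lemma feed_unary l acc : foldl feed (acc, 0) (unary_seq l) = (catrev l acc, 0).
Proof.
elim: l acc => //= x l IH acc; rewrite /unary_seq /= foldl_cat -/(unary_seq l).
suff -> : foldl feed (acc, 0) (rcons (nseq x true) false) = (x :: acc, 0) by [].
rewrite foldl_rcons; suff -> k : foldl feed (acc, k) (nseq x true) = (acc, x + k).
  by rewrite /feed addn0.
by elim: x k => //= x IHx k; rewrite IHx addnS.
Qed.

Lemma unary_seqK : cancel unary_seq blocks.
Proof. by move=> l; rewrite /blocks feed_unary revK. Qed.

Lemma blocks_prefix w w' : prefix w w' -> prefix (blocks w) (blocks w').
Proof.
case/prefixP=> v ->; rewrite /blocks foldl_cat prefix_rev.
elim: v (foldl _ _ _) => [|b v IH] s /=; first exact: suffix_refl.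
apply: suffix_trans (IH _); rewrite /feed; case: b => /=.
  exact: suffix_refl.
exact: (suffix_suffix [:: s.2]).
Qed.

Lemma pr_unary_seq X (eX : Enc X) (l : X -> seq nat) :
  primrec l -> primrec (fun x => unary_seq (l x)).
Proof.
move=> Hl; apply: (@pr_ext _ _ _ _ (fun x =>
  foldr (fun k a => iter k (cons true) (false :: a)) [::] (l x))); first by pr.
move=> x; elim: (l x) => //= k l' ->; rewrite /unary_seq /= cat_rcons.
by elim: k => //= k ->.
Qed.

Lemma pr_blocks X (eX : Enc X) (w : X -> seq bool) :
  primrec w -> primrec (fun x => blocks (w x)).
Proof. by move=> Hw; rewrite /blocks /feed; pr. Qed.

Ltac pr_code := first
  [ pr_machine | simple eapply pr_exec | simple eapply pr_decode
  | simple eapply pr_unary_seq | simple eapply pr_blocks ].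
Ltac pr_rule ::= pr_code.

(** The machine is run for as many steps as there are known input bits.  As a
    step reads at most one bit, the run never meets the unknown part of the
    input. *)
Definition simulate (n : nat) (l : seq nat) : seq nat :=
  blocks (output (run (nth_machine n) (nth false (unary_seq l)) (size (unary_seq l)))).

Lemma pr_simulate X (eX : Enc X) (n : X -> nat) (l : X -> seq nat) :
  primrec n -> primrec l -> primrec (fun x => simulate (n x) (l x)).
Proof.
move=> Hn Hl.
apply: (@pr_ext _ _ _ _ (fun x => blocks (output (iter (size (unary_seq (l x)))
  (fun c => exec (CodeSeq.decode (nth 0 (CodeSeq.decode (n x)) (state c)))
                 (nth false (unary_seq (l x)) (input_pos c)) c) init_config)))).
  by pr.
move=> x; rewrite /simulate /run; congr (blocks (output _)).
by apply: eq_iter => c; rewrite step_exec.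
Qed.

(** * Computing with finite segments of points *)

Lemma prefix_mkseq (T : eqType) (f : nat -> T) m n :
  m <= n -> prefix (mkseq f m) (mkseq f n).
Proof.
move=> lemn; rewrite prefixE size_mkseq; apply/eqP.
by rewrite /mkseq -map_take take_iota (minn_idPl lemn).
Qed.

Lemma prefix_comparable (T : eqType) (a b c : seq T) :
  prefix a c -> prefix b c -> size a <= size b -> prefix a b.
Proof.
rewrite !prefixE => /eqP ea /eqP eb le.
by rewrite -eb take_takel // ea.
Qed.

Definition segment (l : seq nat) (p : baire) := l = mkseq p (size l).

(** The segments need not increase with m: a sequence obtained by simulating
    machines on segments of varying lengths still qualifies. *)
Definition tends (s : nat -> seq nat) (p : baire) : Prop :=
  (forall m, segment (s m) p) /\
  (forall k, exists m, forall m', m <= m' -> k <= size (s m')).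

Lemma segment_prefix l p k : prefix l (mkseq p k) -> segment l p.
Proof.
move=> H; have le : size l <= k by rewrite -(size_mkseq p k) size_prefix.
move: H; rewrite prefixE => /eqP <-.
by rewrite /segment size_take size_mkseq /mkseq -map_take take_iota; congr map; congr iota; lia.
Qed.

Lemma segment_nth l p i : segment l p -> i < size l -> nth 0 l i = p i.
Proof. by move=> seg lti; rewrite seg nth_mkseq. Qed.

Lemma segmentP l p : (forall i, i < size l -> nth 0 l i = p i) -> segment l p.
Proof.
move=> H; apply: (@eq_from_nth _ 0) => [|i lti]; first by rewrite size_mkseq.
by rewrite nth_mkseq // H.
Qed.

Lemma tends_unique s p q : tends s p -> tends s q -> p = q.
Proof.
move=> [Hp Hp'] [Hq _]; apply: functional_extensionality => i.
have [m /(_ m (leqnn m)) lti] := Hp' i.+1.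
by rewrite -(segment_nth (Hp m) lti) -(segment_nth (Hq m) lti).
Qed.

Lemma tends_mkseq p : tends (mkseq p) p.
Proof.
split=> [m|k]; first by rewrite /segment size_mkseq.
by exists k => m; rewrite size_mkseq.
Qed.

Lemma size_unary_seq l : size l <= size (unary_seq l).
Proof.
elim: l => //= x l IH; rewrite /unary_seq /= size_cat size_rcons -/(unary_seq l).
lia.
Qed.

Lemma size_unary_prefix p k : k <= size (unary_prefix p k).
Proof. by rewrite unary_prefixE -{1}(size_mkseq p k) size_unary_seq. Qed.

Lemma unary_seq_prefix l l' : prefix l l' -> prefix (unary_seq l) (unary_seq l').
Proof. by case/prefixP=> v ->; rewrite unary_seq_cat prefix_prefix. Qed.

Lemma nth_prefix (T : eqType) (d : T) a b i :
  prefix a b -> i < size a -> nth d a i = nth d b i.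
Proof. by case/prefixP=> v -> lti; rewrite nth_cat lti. Qed.

Lemma nth_unary_prefix p k j :
  j < size (unary_prefix p k) -> nth false (unary_prefix p k) j = unary p j.
Proof.
move=> ltj; rewrite /unary !unary_prefixE in ltj *.
have ltj1 : j < size (unary_seq (mkseq p j.+1)).
  by rewrite -unary_prefixE; apply: size_unary_prefix.
case/orP: (leq_total k j.+1) => le.
  by apply: nth_prefix ltj; apply/unary_seq_prefix/prefix_mkseq.
by apply/esym; apply: nth_prefix ltj1; apply/unary_seq_prefix/prefix_mkseq.
Qed.

Lemma mkseq_unary p k : mkseq (unary p) (size (unary_prefix p k)) = unary_prefix p k.
Proof.
apply: (@eq_from_nth _ false) => [|i]; rewrite size_mkseq // => lti.
by rewrite nth_mkseq // nth_unary_prefix.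
Qed.

Lemma input_pos_run M u t : input_pos (run M u t) <= t.
Proof.
elim: t => //= t; rewrite /run /=; case: (iter t _ _) => s i w o /= le.
rewrite /step /=; case: (nth Halt M s) => //=; lia.
Qed.

Lemma run_agree M u u' t : (forall i, i < t -> u i = u' i) -> run M u t = run M u' t.
Proof.
elim: t => //= t IH H; rewrite /run /= -!/(run _ _ _) IH => [|i lti]; last by apply: H; lia.
have := input_pos_run M u' t; case: (run M u' t) => s i w o /= le.
by rewrite /step /=; case: (nth Halt M s) => //= ? ?; rewrite H.
Qed.

Lemma output_run M u t t' : t <= t' -> prefix (output (run M u t)) (output (run M u t')).
Proof.
move=> /subnK <-; elim: (t' - t) => [|k IH]; first exact: prefix_refl.
apply: prefix_trans IH _; rewrite addSn /run iterS.
case: (iter _ _ _) => s i w o; rewrite /step /=.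
case: (nth Halt M s) => *; by rewrite /= ?prefix_refl ?prefix_rcons.
Qed.

Lemma simulateE n p l : segment l p ->
  simulate n l = blocks (output (run (nth_machine n) (unary p) (size (unary_seq l)))).
Proof.
move=> seg; rewrite /simulate; congr (blocks (output _)); apply: run_agree => i.
by rewrite seg -unary_prefixE => lti; rewrite nth_unary_prefix.
Qed.

(** Anything written on a part of the input is an initial part of the final
    output, and every initial part of the final output is written after finitely
    many steps, hence with finite knowledge of the input. *)
Lemma tends_simulate n s p q : tends s p -> Phi n p q -> tends (fun m => simulate n (s m)) q.
Proof.
move=> [Hs Hs'] Hphi; split=> [m|k].
  rewrite (simulateE n (Hs m)); set o := output _; set t := size _ in o *.
  have [t0 H0] := Hphi (size o).
  have pre : prefix o (unary_prefix q (size o)).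
    apply: (@prefix_comparable _ _ _ (output (run (nth_machine n) (unary p) (maxn t t0)))).
    - by apply: output_run; lia.
    - by apply: prefix_trans H0 _; apply: output_run; lia.
    - exact: size_unary_prefix.
  apply: (@segment_prefix _ _ (size o)).
  by rewrite -[mkseq _ _]unary_seqK -unary_prefixE; apply: blocks_prefix.
have [t0 H0] := Hphi k; have [m0 Hm] := Hs' t0; exists m0 => m /Hm le.
rewrite (simulateE n (Hs m)) -{1}(size_mkseq q k); apply: size_prefix.
rewrite -[mkseq _ _]unary_seqK -unary_prefixE; apply/blocks_prefix.
apply: prefix_trans H0 _; apply: output_run.
exact: leq_trans le (size_unary_seq _).
Qed.

(** Both outputs are the limit of the same sequence of simulations. *)
Lemma Phi_single n p q q' : Phi n p q -> Phi n p q' -> q = q'.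
Proof.
move=> H H'; apply: (@tends_unique (fun m => simulate n (mkseq p m))).
  exact: tends_simulate (tends_mkseq p) H.
exact: tends_simulate (tends_mkseq p) H'.
Qed.

Lemma Phi_continuous n : continuous (Phi n).
Proof.
move=> p q H k; have [Hq /(_ k)[m /(_ m (leqnn m)) le]] := tends_simulate (tends_mkseq p) H.
exists m => p' q' H' agr i lti.
have [Hq' _] := tends_simulate (tends_mkseq p') H'.
have e : mkseq p m = mkseq p' m.
  apply: (@eq_from_nth _ 0); rewrite !size_mkseq // => j ltj.
  by rewrite !nth_mkseq // agr.
rewrite -(segment_nth (Hq m)); last exact: leq_trans lti le.
by rewrite e -(segment_nth (Hq' m)) // -e; apply: leq_trans lti le.
Qed.

Section Stream.
Variable phi : seq nat -> seq nat.

(** The stream machine for phi parses its input into blocks l and emits, after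
    each input bit, the next bit of the tape of phi l, if phi l is already long
    enough.  Its state holds the parser, the number j of bits emitted so far, and
    the command to emit: 0 for nothing, 1 for false, 2 for true. *)
Definition next_digit (l : seq nat) (j : nat) : nat :=
  if j < size (unary_seq (phi l)) then
    if nth false (unary_seq (phi l)) j then 2 else 1
  else 0.

Definition advance (b : bool) (s : (seq nat * nat) * (nat * nat)) :=
  (feed s.1 b,
   (if next_digit (rev (feed s.1 b).1) s.2.1 == 0 then s.2.1 else s.2.1.+1,
    next_digit (rev (feed s.1 b).1) s.2.1)).

Fixpoint stream_state (u : nat -> bool) (n : nat) :=
  if n is n'.+1 then advance (u n') (stream_state u n') else (([::], 0), (0, 0)).

Definition emitted_bits u n : seq bool :=
  flatten (mkseq (fun k => emitted (stream_state u k.+1).2.2) n).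

Lemma stream_state_feed u n : (stream_state u n).1 = foldl feed ([::], 0) (mkseq u n).
Proof. by elim: n => // n IH; rewrite mkseqS foldl_rcons -IH. Qed.

Lemma emitted_bits_machine : primrec phi -> exists M, forall u n, exists t,
  output (run M u t) = emitted_bits u n.
Proof.
move=> Hphi.
have Hn : primrec (fun z : seq nat * nat => next_digit z.1 z.2).
  have Hw : primrec (fun z : seq nat * nat => unary_seq (phi z.1)).
    by apply: pr_unary_seq; pr.
  by rewrite /next_digit; pr.
have Ha b : primrec (advance b).
  rewrite /advance /feed; case: b; pr; try by apply: (pr_comp2 Hn); pr.
have [e1 H1] := Ha true; have [e0 H0] := Ha false.
have [g Hg] : primrec (fun s : (seq nat * nat) * (nat * nat) => s.2.2) by pr.
exists (transducer e0 e1 g) => u n.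
have Hst k : transducer_state u e0 e1 k = enc (stream_state u k).
  by elim: k => //= k ->; case: (u k); rewrite ?H0 ?H1.
have [t Ht] := run_transducer u e0 e1 g n; exists t; rewrite Ht.
by rewrite /transduced /emitted_bits; congr flatten; apply: eq_mkseq => k; rewrite Hst Hg.
Qed.

(** Invariant: the output is the initial part of length J n of the tape of q.
    It grows without bound because the segments phi (L n) do. *)
Lemma emitted_bits_limit p q : tends (fun m => phi (mkseq p m)) q ->
  forall k, exists n, prefix (unary_prefix q k) (emitted_bits (unary p) n).
Proof.
move=> [Hseg Hgrow].
pose u := unary p; pose J n := (stream_state u n).2.1.
pose L n := rev (stream_state u n).1.1.
have LE n : L n = blocks (mkseq u n) by rewrite /L stream_state_feed.
have segL n : segment (L n) p.
  apply: (@segment_prefix _ _ n); rewrite LE -[mkseq p n]unary_seqK -unary_prefixE.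
  apply: blocks_prefix; rewrite -mkseq_unary; apply: prefix_mkseq.
  exact: size_unary_prefix.
have growL m : exists n0, forall n, n0 <= n -> m <= size (L n).
  exists (size (unary_prefix p m)) => n le.
  rewrite -{1}(size_mkseq p m); apply: size_prefix.
  rewrite LE -[mkseq p m]unary_seqK -unary_prefixE; apply: blocks_prefix.
  by rewrite -mkseq_unary; apply: prefix_mkseq.
have segP n : segment (phi (L n)) q by rewrite segL.
have growP k : exists n0, forall n, n0 <= n -> k <= size (unary_seq (phi (L n))).
  have [m Hm] := Hgrow k; have [n0 Hn0] := growL m; exists n0 => n le.
  apply: leq_trans (size_unary_seq _); rewrite segL; apply: Hm; exact: Hn0.
have digE n j : next_digit (L n) j =
    if j < size (unary_seq (phi (L n))) then if unary q j then 2 else 1 else 0.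
  rewrite /next_digit; case: ifP => // lt.
  by rewrite {1}segP -unary_prefixE nth_unary_prefix // unary_prefixE -segP.
have JS n : J n.+1 = if J n < size (unary_seq (phi (L n.+1))) then (J n).+1 else J n.
  rewrite /J /= -[rev _]/(L n.+1) digE; case: (_ < _) => //; by case: (unary q _).
have outE n : emitted_bits u n = mkseq (unary q) (J n).
  elim: n => [//|n IH]; rewrite /emitted_bits mkseqS flatten_rcons -/(emitted_bits u n) IH.
  rewrite JS /= -[rev _]/(L n.+1) digE -/(J n); case: ifP => _; last by rewrite cats0.
  by rewrite mkseqS -cats1; case: (unary q _).
have Jmono n n' : n <= n' -> J n <= J n'.
  move=> /subnK <-; elim: (n' - n) => //= d IH; rewrite addSn JS; case: ifP; lia.
have Jgrow j : exists n, j <= J n.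
  elim: j => [|j [n Hn]]; first by exists 0.
  have [n0 Hn0] := growP j.+1; pose n1 := maxn n n0; exists n1.+1.
  have := Jmono n n1 (leq_maxl _ _); rewrite JS; case: ifP => //; first lia.
  have := Hn0 n1.+1; have : n0 <= n1.+1 by rewrite /n1; lia.
  move=> a b; have := b a; lia.
move=> k; have [n le] := Jgrow (size (unary_prefix q k)).
by exists n; rewrite outE -mkseq_unary; apply: prefix_mkseq.
Qed.

(** Convergence is only demanded at the p in question; at other inputs the
    machine may write anything. *)
Theorem Phi_of_primrec : primrec phi -> exists n, forall p q,
  tends (fun m => phi (mkseq p m)) q -> Phi n p q.
Proof.
move=> /emitted_bits_machine[M HM]; exists (code_machine M) => p q Hq k.
rewrite code_machineK; have [n pre] := emitted_bits_limit Hq k.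
by have [t Ht] := HM (unary p) n; exists t; rewrite Ht.
Qed.
End Stream.

(** * Pairs and names on finite segments *)

Definition pairl (l l' : seq nat) : seq nat :=
  mkseq (fun n => if odd n then nth 0 l' n./2 else nth 0 l n./2)
        (* twice the minimum of the two lengths *)
        (size l - (size l - size l')).*2.
Definition fstl (l : seq nat) := mkseq (fun i => nth 0 l i.*2) (size l)./2.
Definition sndl (l : seq nat) := mkseq (fun i => nth 0 l i.*2.+1) (size l)./2.

Lemma pr_pairl X (eX : Enc X) (l l' : X -> seq nat) :
  primrec l -> primrec l' -> primrec (fun x => pairl (l x) (l' x)).
Proof. by move=> Hl Hl'; rewrite /pairl; pr. Qed.

Lemma pr_fstl X (eX : Enc X) (l : X -> seq nat) :
  primrec l -> primrec (fun x => fstl (l x)).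
Proof. by move=> Hl; rewrite /fstl; pr. Qed.

Lemma pr_sndl X (eX : Enc X) (l : X -> seq nat) :
  primrec l -> primrec (fun x => sndl (l x)).
Proof. by move=> Hl; rewrite /sndl; pr. Qed.

Lemma bpair_even p q i : bpair p q i.*2 = p i.
Proof. by rewrite /bpair odd_double doubleK. Qed.

Lemma bpair_odd p q i : bpair p q i.*2.+1 = q i.
Proof. by rewrite /bpair /= odd_double uphalf_double. Qed.

Lemma bpair_inj p q p' q' : bpair p q = bpair p' q' -> p = p' /\ q = q'.
Proof.
move=> e; split; apply: functional_extensionality => i.
  by rewrite -(bpair_even p q) e bpair_even.
by rewrite -(bpair_odd p q) e bpair_odd.
Qed.

Lemma tends_pairl s t p q :
  tends s p -> tends t q -> tends (fun m => pairl (s m) (t m)) (bpair p q).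
Proof.
move=> [Hs Hs'] [Ht Ht']; split=> [m|k].
  apply: segmentP => i; rewrite size_mkseq => lti; rewrite nth_mkseq // /bpair.
  by case: ifP => _; [apply: segment_nth (Ht m) _ | apply: segment_nth (Hs m) _]; lia.
have [m Hm] := Hs' k; have [m' Hm'] := Ht' k; exists (m + m') => n le.
have := Hm n; have := Hm' n; rewrite size_mkseq; lia.
Qed.

Lemma tends_fstl s p q : tends s (bpair p q) -> tends (fun m => fstl (s m)) p.
Proof.
move=> [Hs Hs']; split=> [m|k].
  apply: segmentP => i; rewrite size_mkseq => lti; rewrite nth_mkseq //.
  by rewrite (segment_nth (Hs m)) ?bpair_even; lia.
by have [m Hm] := Hs' k.*2; exists m => n /Hm; rewrite size_mkseq; lia.
Qed.

Lemma tends_sndl s p q : tends s (bpair p q) -> tends (fun m => sndl (s m)) q.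
Proof.
move=> [Hs Hs']; split=> [m|k].
  apply: segmentP => i; rewrite size_mkseq => lti; rewrite nth_mkseq //.
  by rewrite (segment_nth (Hs m)) ?bpair_odd; lia.
by have [m Hm] := Hs' k.*2; exists m => n /Hm; rewrite size_mkseq; lia.
Qed.

Lemma tends_behead s p : tends s p -> tends (fun m => behead (s m)) (btail p).
Proof.
move=> [Hs Hs']; split=> [m|k].
  apply: segmentP => i; rewrite size_behead nth_behead => lti.
  by rewrite (segment_nth (Hs m)) //; lia.
by have [m Hm] := Hs' k.+1; exists m => n /Hm; rewrite size_behead; lia.
Qed.

Definition bcons (n : nat) (p : baire) : baire := fun i => if i is j.+1 then p j else n.

Lemma tends_cons n s p : tends s p -> tends (fun m => n :: s m) (bcons n p).
Proof.
move=> [Hs Hs']; split=> [m|k].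
  by apply: segmentP => -[|i] //= lti; apply: segment_nth (Hs m) lti.
have [m Hm] := Hs' k; exists m => m' /Hm /=; lia.
Qed.

(** The first entry of a name of a function is the code of a machine; before it
    is known, nothing can be run. *)
Definition apply_name (q r : seq nat) : seq nat :=
  if q is n :: q' then simulate n (pairl q' r) else [::].

Lemma tends_apply_name s t q r v : tends s q -> tends t r ->
  Phi (q 0) (bpair (btail q) r) v -> tends (fun m => apply_name (s m) (t m)) v.
Proof.
move=> Hs Ht Hv; have [Hu Hu'] := tends_simulate (tends_pairl (tends_behead Hs) Ht) Hv.
have E m : s m <> [::] -> apply_name (s m) (t m) = simulate (q 0) (pairl (behead (s m)) (t m)).
  case: Hs => /(_ m) + _; case: (s m) => // n l seg _.
  by have <- := segment_nth (i := 0) seg.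
split=> [m|k]; first by case e : (s m) => [|n l] //; rewrite -e E ?e // -e; apply: Hu.
have [m Hm] := Hu' k; have [m1 Hm1] := Hs.2 1; exists (m + m1) => n le.
rewrite E; first by apply: Hm; lia.
by move=> e; have := Hm1 n; rewrite e /=; lia.
Qed.

Lemma pr_apply_name X (eX : Enc X) (q r : X -> seq nat) :
  primrec q -> primrec r -> primrec (fun x => apply_name (q x) (r x)).
Proof.
move=> Hq Hr; rewrite /apply_name; pr.
by apply: pr_simulate; pr; apply: pr_pairl; pr.
Qed.

Lemma pr_has0 X (eX : Enc X) (l : X -> seq nat) :
  primrec l -> primrec (fun x => has (pred1 0) (l x)).
Proof.
move=> Hl; apply: (@pr_ext _ _ _ _ (fun x =>
  foldr (fun n b => (n == 0) || b) false (l x))); first by pr.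
by move=> x; elim: (l x) => //= n l' ->.
Qed.

Ltac pr_stream := first
  [ pr_code | simple eapply pr_simulate | simple eapply pr_pairl
  | simple eapply pr_fstl | simple eapply pr_sndl | simple eapply pr_apply_name
  | simple eapply pr_has0 ].
Ltac pr_rule ::= pr_stream.

Lemma tends_has0 s v : tends s v ->
  (exists m, has (pred1 0) (s m)) <-> exists n, v n = 0.
Proof.
move=> [Hs Hs']; split=> [[m /(has_nthP 0)[i lti /eqP e]]|[n e]].
  by exists i; rewrite -(segment_nth (Hs m)).
have [m /(_ m (leqnn m)) ltn] := Hs' n.+1; exists m; apply/(has_nthP 0).
by exists n => //; rewrite (segment_nth (Hs m)) //= e.
Qed.

(** * Closed choice without realizers *)

Definition names_point (A : baire -> Prop) (q : baire) (c : subspace A) : Prop :=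
  exists2 C : closed_set (@sub_rep A), psi_minus q C & sval C c.

Lemma psi_minusP (A : baire -> Prop) q (C : closed_set (@sub_rep A)) :
  psi_minus q C -> forall c : subspace A,
  exists2 v, Phi (q 0) (bpair (btail q) (sval c)) v & (exists n, v n = 0) <-> ~ sval C c.
Proof.
case=> _ H c; have [||v [b [Hv [Hb1 Hb2] [Hc1 Hc2]]]] := H (sval c) c; first by [].
  case: (classic (~ sval C c)) => h; first by exists true; split.
  by exists false; split=> //.
by exists v => //; split=> [/Hb2/Hc1|/Hc2/Hb1].
Qed.

(** Realizers of the characteristic function are single-valued on names, so a
    name determines its closed set up to extension. *)
Lemma psi_minus_ext (A : baire -> Prop) q (C C' : closed_set (@sub_rep A)) c :
  psi_minus q C -> psi_minus q C' -> sval C c -> sval C' c.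
Proof.
move=> /psi_minusP/(_ c)[v Hv e] /psi_minusP/(_ c)[v' Hv' e'] Cc; apply: NNPP.
by rewrite -e' -(Phi_single Hv Hv') e => /(_ Cc).
Qed.

(** A canonical realizer of closed choice, undefined off the names of non-empty
    closed sets: from its being applicable to q one learns that q is such a
    name. *)
Definition some_point (A : baire -> Prop) (q s : baire) : Prop :=
  exists2 c : subspace A, names_point q c &
    s = sval (epsilon (inhabits c) (@names_point A q)).

Lemma some_point_single A : single_valued (some_point A).
Proof.
move=> q s s' [c _ ->] [c' _ ->].
by rewrite (proof_irrelevance _ (inhabits c) (inhabits c')).
Qed.

Lemma realizer_choice (A : baire -> Prop) (G : mvfun baire baire) :
  single_valued G ->
  (forall q (c : subspace A), names_point q c -> exists2 c' : subspace A,
     names_point q c' & G q (sval c')) ->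
  realizer (@psi_minus _ (@sub_rep A)) (@sub_rep A) G
    (@closed_choice _ (@sub_rep A)).
Proof.
move=> sG HG; split=> // q C HC [c Cc].
have [|c' [C' HC' Cc'] Gc'] := HG q c; first by exists C.
by exists (sval c'), c'; split=> //; apply: psi_minus_ext HC' HC Cc'.
Qed.

(** What a Weihrauch reduction to closed choice means pointwise: from p, [Phi h]
    computes a name of a non-empty closed set, every point of which can play the
    role of the answer. *)
Definition choice_reduction X Y (dX : mvfun baire X) (dY : mvfun baire Y)
    (f : mvfun X Y) (A : baire -> Prop) (k h : nat) : Prop :=
  forall p x, dX p x -> dom f x -> exists q (C : baire -> Prop),
  [/\ Phi h p q,
      exists2 a, A a & C a,
      forall a, A a -> exists2 v, Phi (q 0) (bpair (btail q) a) v &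
        (exists n, v n = 0) <-> ~ C a &
      forall a, A a -> C a ->
        exists r y, [/\ Phi k (bpair p a) r, dY r y & f x y]].

(** Applying the reduction to [some_point] shows that H p names a non-empty
    closed set.  A realizer may send that one name to any point of the set, so
    the reduction succeeds whichever point is answered. *)
Lemma choice_reduction_of_le X Y (dX : mvfun baire X) (dY : mvfun baire Y)
    (f : mvfun X Y) (A : baire -> Prop) :
  le_choice dX dY f A -> exists k h, choice_reduction dX dY f A k h.
Proof.
case=> K [H [[k HK] [h HH] red]]; exists k, h => p x px fx.
have [|_ /(_ p x px fx) [_ [_ [[q [s [Hq [c [C HC Cc] _] _]]] _ _]]]] :=
    red (some_point A).
  apply: realizer_choice; first exact: some_point_single.
  move=> q c qc; exists (epsilon (inhabits c) (@names_point A q)); last by exists c.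
  by apply: epsilon_spec; exists c.
exists q, (fun a => exists2 c : subspace A, sval c = a & sval C c).
split; [by apply/HH | | |].
- by exists (sval c); [apply: (svalP c) | exists c].
- move=> a Aa; have [v Hv e] := psi_minusP HC (exist _ a Aa); exists v => //.
  rewrite e; split=> nC; last by move=> Ca; apply: nC; exists (exist _ a Aa).
  case=> -[a' Aa'] /= ea; move: Aa'; rewrite ea => Aa' Ca; apply: nC.
  by rewrite (proof_irrelevance _ Aa Aa').
- move=> a Aa [c0 <- Cc0].
  pose G q' s := (q' = q /\ s = sval c0) \/ (q' <> q /\ some_point A q' s).
  have [|_ /(_ p x px fx) [r [y [[q' [s' [Hq' Gs' HKr]]] yr fy]]]] := red G.
    apply: realizer_choice.
      move=> q1 s1 s2 [[e ->]|[n h1]] [[e' ->]|[n' h2]] //.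
      exact: some_point_single h1 h2.
    move=> q1 c1 q1c1; case: (classic (q1 = q)) => [->|ne].
      by exists c0; [exists C | left].
    exists (epsilon (inhabits c1) (@names_point A q1)).
      by apply: epsilon_spec; exists c1.
    by right; split=> //; exists c1.
  have e : q' = q by apply: (@Phi_single h p); apply/HH.
  exists r, y; split=> //; apply/HK.
  by case: Gs' HKr => [[_ ->]|[]].
Qed.

(** The set named by q is closed because machines are continuous; a realizer
    answers q by one of its points. *)
Lemma le_of_choice_reduction X Y (dX : mvfun baire X) (dY : mvfun baire Y)
    (f : mvfun X Y) (A : baire -> Prop) k h :
  choice_reduction dX dY f A k h -> le_choice dX dY f A.
Proof.
move=> red; exists (Phi k), (Phi h); split; [by exists k | by exists h |].
move=> G [sG HG]; split.
  move=> p r r' [q [s [Hq Gs Kr]]] [q' [s' [Hq' Gs' Kr']]].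
  have e := Phi_single Hq Hq'; rewrite -e in Gs'.
  by rewrite (sG _ _ _ Gs Gs') in Kr; apply: Phi_single Kr Kr'.
move=> p x px fx; have [q [C [Hq [a Aa Ca] Hchi HK]]] := red p x px fx.
pose F r s := Phi (q 0) (bpair (btail q) r) s.
pose C0 (c : subspace A) := C (sval c).
have rF : realizer (@sub_rep A) sierp_rep F (chi (fun c => ~ C0 c)).
  split=> [r s s'|r c -> _]; first exact: Phi_single.
  have [v Hv e] := Hchi (sval c) (svalP c).
  case: (classic (exists n, v n = 0)) => ex.
    by exists v, true; split=> //; split=> // _; apply/e.
  by exists v, false; split=> //; split=> // /e.
have cF : is_closed (@sub_rep A) C0.
  exists F => // r s Hs n; have [m Hm] := Phi_continuous Hs n.
  exists m => r' s' Hs' agr; apply: (Hm _ _ Hs') => i lti.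
  by rewrite /bpair; case: ifP => // _; apply: agr; lia.
have [||s [c [Gs es Cc]]] := HG q (exist _ C0 cF); first exact: rF.
  by exists (exist _ a Aa).
have [r [y [Kr yr fy]]] := HK _ (svalP c) Cc.
exists r, y; split=> //; exists q, s; split=> //.
by have -> : s = sval c := es.
Qed.

(** * The product of two reductions *)

Section Composition.
Variables (kf hf kg hg : nat).

(** These functions are applied to segments of <p, <a, b>>. *)
Definition comp_name (l : seq nat) : seq nat :=
  simulate kg (pairl (fstl l) (sndl (sndl l))).

(** Bounded search for evidence that b is outside the set named through [hg], or
    that a is outside the set named through [hf]. *)
Definition outside (l : seq nat) : bool :=
  has (pred1 0) (apply_name (simulate hg (fstl l)) (sndl (sndl l))) ||
  has (pred1 0) (apply_name (simulate hf (comp_name l)) (fstl (sndl l))).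

(** Entry i uses the first i entries of the input alone, so longer segments of
    the input yield longer segments of one and the same stream.  The stream is
    total even where the two computations diverge. *)
Definition outside_stream (l : seq nat) : seq nat :=
  mkseq (fun i => if outside (mkseq (nth 0 l) i) then 0 else 1) (size l).

Definition comp_output (l : seq nat) : seq nat :=
  simulate kf (pairl (comp_name l) (fstl (sndl l))).

Lemma pr_comp_output : primrec comp_output.
Proof. by rewrite /comp_output /comp_name; pr. Qed.

Lemma pr_outside_stream : primrec outside_stream.
Proof. by rewrite /outside_stream /outside /comp_name; pr. Qed.

Definition outside_point (w : baire) : baire :=
  fun i => if outside (mkseq w i) then 0 else 1.

Lemma tends_outside_stream w :
  tends (fun m => outside_stream (mkseq w m)) (outside_point w).
Proof.
split=> [m|k]; last by exists k => m; rewrite !size_mkseq.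
apply: segmentP => i; rewrite !size_mkseq => lti; rewrite nth_mkseq ?size_mkseq //.
rewrite /outside_point; congr (if outside _ then _ else _).
apply: (@eq_from_nth _ 0) => [|j]; rewrite !size_mkseq // => ltj.
by rewrite !nth_mkseq //; lia.
Qed.

Lemma outside_pointP w : (exists n, outside_point w n = 0) <-> exists n, outside (mkseq w n).
Proof.
by rewrite /outside_point; split=> -[n Hn]; exists n; move: Hn; case: (outside _).
Qed.
End Composition.

Theorem theorem7p3 (A B : baire -> Prop) (X Y Z : Type)
  (dX : mvfun baire X) (dY : mvfun baire Y) (dZ : mvfun baire Z)
  (hX : representation dX) (hY : representation dY) (hZ : representation dZ)
  (g : mvfun X Y) (f : mvfun Y Z) :
  le_choice dY dZ f A -> le_choice dX dY g B ->
  le_choice dX dZ (mvcomp f g) (bprod A B).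
Proof.
move=> /choice_reduction_of_le[kf [hf Rf]] /choice_reduction_of_le[kg [hg Rg]].
have [n0 Hn0] := Phi_of_primrec (pr_outside_stream hf kg hg).
have [k Hk] := Phi_of_primrec (pr_comp_output kf kg).
have [h Hh] : exists h, forall p q, tends (fun m => n0 :: mkseq p m) q -> Phi h p q.
  by apply: Phi_of_primrec; pr.
apply: (@le_of_choice_reduction _ _ _ _ _ _ k h) => p x px [z [gx domf _]].
have [q [CB [Hq [b Bb CBb] HB KB]]] := Rg p x px gx.
(* Phrased by the computations alone, without choosing a value y. *)
pose CA b a := exists r q' v, [/\ Phi kg (bpair p b) r, Phi hf r q',
  Phi (q' 0) (bpair (btail q') a) v & forall n, v n <> 0].
pose C w := exists a b, [/\ w = bpair a b, CB b & CA b a].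
(* On B_p the second reduction applies, and CA b' is the set that it names. *)
have through b' : B b' -> CB b' -> exists r y q' CA',
    [/\ Phi kg (bpair p b') r, dY r y, g x y & Phi hf r q'] /\
    [/\ exists2 a, A a & CA' a,
        forall a, A a -> exists2 v, Phi (q' 0) (bpair (btail q') a) v &
          (exists n, v n = 0) <-> ~ CA' a,
        forall a, A a -> CA' a -> CA b' a &
        forall a, A a -> CA b' a ->
          exists r' z, [/\ Phi kf (bpair r a) r', dZ r' z & f y z]].
  move=> Bb' CBb'; have [r [y [Hr ry gy]]] := KB b' Bb' CBb'.
  have [q' [CA' [Hq' exA HA KA]]] := Rf r y ry (domf y gy).
  exists r, y, q', CA'; split; first by split.
  split=> // a Aa.
    move=> Ca; exists r, q'; have [v Hv e] := HA a Aa; exists v; split=> //.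
    by move=> n v0; have /e : exists n, v n = 0 by [exists n]; apply.
  case=> r1 [q1 [v [Hr1 Hq1 Hv nv]]]; apply: KA => //; apply: NNPP => nC.
  have [v' Hv' e'] := HA a Aa; move: Hv' e'.
  rewrite -(Phi_single Hr1 Hr) in Hq'; rewrite -(Phi_single Hq1 Hq').
  by move=> Hv'; rewrite -(Phi_single Hv Hv') => -[_ /(_ nC)[n /nv]].
exists (bcons n0 p), C; split.
- by apply: Hh; apply: tends_cons (tends_mkseq p).
- have [r [y [q' [CA' [_ [[a Aa Ca] _ toCA _]]]]]] := through b Bb CBb.
  exists (bpair a b); first by exists a, b.
  by exists a, b; split=> //; apply: toCA.
(* The stream of the name n0 :: p has a zero exactly outside C_p. *)
- move=> _ [a [b' [Aa Bb' ->]]].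
  pose w := bpair p (bpair a b'); exists (outside_point hf kg hg w).
    exact/Hn0/tends_outside_stream.
  have tw := tends_mkseq w; have tp := tends_fstl tw; have tab := tends_sndl tw.
  have ta := tends_fstl tab; have tb := tends_sndl tab.
  have [v Hv ev] := HB b' Bb'.
  have tv := tends_has0 (tends_apply_name (tends_simulate tp Hq) tb Hv).
  rewrite outside_pointP; split=> [[n /orP[]] h0|nC].
  + have /ev nCB : exists n, v n = 0 by apply/tv; exists n.
    by case=> a1 [b1 [/bpair_inj[_ <-] /nCB]].
  + case=> a1 [b1 [/bpair_inj[<- <-] _ [r [q' [v' [Hr Hq' Hv' nv']]]]]].
    have tr := tends_simulate (tends_pairl tp tb) Hr.
    have tv' := tends_has0 (tends_apply_name (tends_simulate tr Hq') ta Hv').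
    by have [n' /nv'] : exists n, v' n = 0 by [apply/tv'; exists n].
  + case: (classic (CB b')) => CBb'; last first.
      by have /tv[m Hm] := ev.2 CBb'; exists m; apply/orP; left.
    have [r [y [q' [CA' [[Hr _ _ Hq'] [_ HA toCA _]]]]]] := through b' Bb' CBb'.
    have [v' Hv' ev'] := HA a Aa.
    have tr := tends_simulate (tends_pairl tp tb) Hr.
    have tv' := tends_has0 (tends_apply_name (tends_simulate tr Hq') ta Hv').
    have /ev'.2/tv'[m Hm] : ~ CA' a.
      by move=> Ca; apply: nC; exists a, b'; split=> //; apply: toCA.
    by exists m; apply/orP; right.
- move=> _ [a [b' [Aa Bb' ->]]] [a1 [b1 [/bpair_inj[<- <-] CBb' CAa]]].
  have [r [y [q' [CA' [[Hr ry gy _] [_ _ _ out]]]]]] := through b' Bb' CBb'.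
  have [r' [z' [Hr' rz fz]]] := out a Aa CAa.
  exists r', z'; split=> //; last by split=> //; exists y.
  apply: Hk.
  have tw := tends_mkseq (bpair p (bpair a b')).
  have tp := tends_fstl tw; have tab := tends_sndl tw.
  have ta := tends_fstl tab; have tb := tends_sndl tab.
  exact: tends_simulate (tends_pairl (tends_simulate (tends_pairl tp tb) Hr) ta) Hr'.
Qed.
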